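(* Let $f:\mathbb{C}^{n}\to\mathbb{C}$, $n\geqslant2$, be a non-constant polynomial. For $\lambda_{0}\in\mathbb{C}$ the following conditions are equivalent: (i) $\lambda_{0}\in K_{\infty}(f)$, (ii) $\widetilde{\mathcal{L}}_{\infty,\lambda_{0}}(f)<-1$, (iii) $\mathcal{L}_{\infty,\lambda_{0}}(f)<-1$.
   Context: $\nabla f:\mathbb{C}^n\to\mathbb{C}^n$ is the gradient (vector of partial derivatives) of $f$; $|\cdot|$ is the maximum norm. $f$ satisfies the Malgrange condition for $\lambda_0\in\mathbb{C}$ if there are $\eta_0,\delta_0,R_0>0$ such that for all $p\in\mathbb{C}^n$: $|p|>R_0$ and $|f(p)-\lambda_0|<\delta_0$ imply $|p|\,|\nabla f(p)|>\eta_0$. $K_\infty(f)$ is the set of $\lambda\in\mathbb{C}$ for which the Malgrange condition does not hold. For a polynomial mapping $F:\mathbb{C}^{n}\to\mathbb{C}^{m}$ and an unbounded set $S\subset\mathbb{C}^{n}$ let $N(F|S):=\{\nu\in\mathbb{R}:\exists A,B>0\ \forall z\in S\ (|z|>B\Rightarrow|F(z)|\geqslant A|z|^{\nu})\}$; $\mathcal{L}_\infty(F|S):=\sup N(F|S)$ if $N(F|S)\neq\emptyset$ and $-\infty$ otherwise. For $\lambda_0\in\mathbb{C}$, $$\widetilde{\mathcal{L}}_{\infty,\lambda_{0}}(f):=\lim_{\delta\to0^{+}}\mathcal{L}_{\infty}(\nabla f|f^{-1}(D_{\delta})),\qquad D_{\delta}:=\{\lambda\in\mathbb{C}:|\lambda-\lambda_{0}|<\delta\}.$$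 A function meromorphic at infinity is given by a Laurent series $\sum_{m=k}^{-\infty}c_mt^m$, $k\in\mathbb{Z}$, convergent in a punctured neighbourhood of $\infty\in\overline{\mathbb{C}}$; its degree $\deg$ is the largest $m$ with $c_m\ne0$, $\deg 0:=-\infty$; for a tuple of such functions, $\deg$ is the maximum of the degrees of the components. For $\lambda\in\mathbb{C}$, $$\mathcal{L}_{\infty,\lambda}(f):=\inf_{\Phi}\frac{\deg(\nabla f\circ\Phi)}{\deg\Phi},$$ the infimum taken over all $n$-tuples $\Phi=(\varphi_1,\dots,\varphi_n)$ of functions meromorphic at infinity with $\deg\Phi>0$ and $\deg((f-\lambda)\circ\Phi)<0$. *)

(* Defs.v *)
From mathcomp Require Import all_boot all_order all_algebra.
From mathcomp Require Import all_classical all_reals all_analysis.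
From mathcomp Require Import complex.
(* Not imported: its notations clash with those of mathcomp-analysis. *)
From mathcomp Require mpoly.

Set Implicit Arguments.
Unset Strict Implicit.
Unset Printing Implicit Defensive.

Import Order.TTheory GRing.Theory Num.Theory.
Import numFieldNormedType.Exports.

Local Open Scope classical_set_scope.
Local Open Scope complex_scope.
Local Open Scope ring_scope.

(* [`|z|] on [R[i]] is [R[i]]-valued; moduli are taken in [R] instead. *)
Definition cmod (R : realType) (z : R[i]) : R := ComplexField.Normc.normc z.

Definition maxnorm (R : realType) (n : nat) (z : 'rV[R[i]]_n) : R :=
  \big[Num.max/0]_(i < n) cmod (z 0 i).

Definition peval (R : realType) (n : nat) (f : mpoly.mpoly n R[i])
  (z : 'rV[R[i]]_n) : R[i] := mpoly.meval (z 0) f.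

Definition grad (R : realType) (n : nat) (f : mpoly.mpoly n R[i])
  (z : 'rV[R[i]]_n) : 'rV[R[i]]_n := \row_(i < n) peval (mpoly.mderiv i f) z.

Definition malgrange (R : realType) (n : nat) (f : mpoly.mpoly n R[i])
  (lambda0 : R[i]) : Prop :=
  exists eta0 delta0 R0 : R,
    [/\ 0 < eta0, 0 < delta0, 0 < R0 &
      forall p : 'rV[R[i]]_n,
        R0 < maxnorm p -> cmod (peval f p - lambda0) < delta0 ->
        eta0 < maxnorm p * maxnorm (grad f p)].

Definition Kinfty (R : realType) (n : nat) (f : mpoly.mpoly n R[i]) :
  set R[i] := [set lambda | ~ malgrange f lambda].

(* For an unbounded [S], the exponents of the lower estimates
   [|F(z)| >= A |z|^nu] valid for large [z] in [S]. *)
Definition loj_exponents (R : realType) (n m : nat)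
  (F : 'rV[R[i]]_n -> 'rV[R[i]]_m) (S : set 'rV[R[i]]_n) : set R :=
  [set nu | exists A B : R, [/\ 0 < A, 0 < B &
    forall z, S z -> B < maxnorm z -> A * maxnorm z `^ nu <= maxnorm (F z)]].

(* [ereal_sup set0 = -oo]. *)
Definition loj_infty (R : realType) (n m : nat)
  (F : 'rV[R[i]]_n -> 'rV[R[i]]_m) (S : set 'rV[R[i]]_n) : \bar R :=
  ereal_sup [set nu%:E | nu in loj_exponents F S].

Definition disc (R : realType) (lambda0 : R[i]) (delta : R) : set R[i] :=
  [set lambda | cmod (lambda - lambda0) < delta].

(* [loj_infty (grad f) (peval f @^-1` disc lambda0 delta)] is nonincreasing in
   [delta], so that this limit always exists in [\bar R]. *)
Definition loj_infty_fiber (R : realType) (n : nat) (f : mpoly.mpoly n R[i])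
  (lambda0 : R[i]) : \bar R :=
  lim (loj_infty (grad f) (peval f @^-1` disc lambda0 delta)
       @[delta --> (0 : R)^'+]).

(* [c m] is the coefficient of [t ^ m]; near infinity,
   [g t] is the sum of [c m * t ^ m] over [m = k, k - 1, k - 2, ...]. *)
Definition laurent_at_infty (R : realType) (g : R[i] -> R[i])
  (c : int -> R[i]) : Prop :=
  exists k : int, (forall m : int, k < m -> c m = 0) /\
    exists r : R, 0 < r /\ forall t : R[i], r < cmod t ->
      \sum_(0 <= j < N) c (k - j%:Z) * t ^ (k - j%:Z) @[N --> \oo]
        --> (g t : R[i]^o).

Definition meromorphic_at_infty (R : realType) (g : R[i] -> R[i]) : Prop :=
  exists c, laurent_at_infty g c.

(* The Laurent expansion of a function meromorphic at infinity is unique and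
   its exponents are bounded above, so this supremum is the largest [m] with
   nonzero coefficient, and it is [-oo] if [g] vanishes near infinity. *)
Definition deg_infty (R : realType) (g : R[i] -> R[i]) : \bar R :=
  ereal_sup [set (m%:~R)%:E |
    m in [set m : int | exists2 c, laurent_at_infty g c & c m <> 0]].

Definition tuple_deg_infty (R : realType) (n : nat)
  (Phi : R[i] -> 'rV[R[i]]_n) : \bar R :=
  \big[maxe/-oo%E]_(i < n) deg_infty (fun t => Phi t 0 i).

Definition admissible_curve (R : realType) (n : nat) (f : mpoly.mpoly n R[i])
  (lambda : R[i]) (Phi : R[i] -> 'rV[R[i]]_n) : Prop :=
  [/\ forall i, meromorphic_at_infty (fun t => Phi t 0 i),
      (0 < tuple_deg_infty Phi)%E &
      (deg_infty (fun t => (peval f (Phi t) - lambda)%R) < 0)%E].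

(* Here [tuple_deg_infty Phi] is a positive real, and the quotient is [-oo]
   when the numerator is. *)
Definition loj_infty_curves (R : realType) (n : nat) (f : mpoly.mpoly n R[i])
  (lambda : R[i]) : \bar R :=
  ereal_inf [set (tuple_deg_infty (fun t => grad f (Phi t))
                  / tuple_deg_infty Phi)%E |
    Phi in [set Phi | admissible_curve f lambda Phi]].

(* Main.v *)
(* Curve selection carries the proof. If the Malgrange condition fails, then for
   every s >= 1 the closed semialgebraic set of points p with |p| >= s,
   |f(p) - lambda0| <= 1/s and |p| |grad f(p)| <= 1/s, in Euclidean norms and up
   to constants, is nonempty. Its point that is lexicographically smallest among
   those of least norm is unique and definable, so by quantifier elimination its
   coordinates are algebraic functions of s. In an ultrapower of the reals, in
   which s becomes an infinitely large element, they generate a finite extension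
   of R(s); the place of that field over R is discrete, because n elements whose
   orders differ modulo the order of s are independent over R(s). Hence all
   coordinates have Laurent expansions with real coefficients in one infinitely
   large element u. As deg Phi > 0, deg ((f - lambda0) o Phi) < 0 and
   deg Phi + deg (grad f o Phi) < 0 are open conditions, the expansions may be
   truncated: Phi is a tuple of Laurent polynomials, and neither convergence nor
   Puiseux's theorem is needed. The converse implications compare the growth of
   both sides of the inequalities along a curve. *)

Require Import Defs.
From HB Require Import structures.
From mathcomp Require Import all_boot all_order all_algebra separable.
From mathcomp Require Import all_classical all_reals all_analysis.
From mathcomp Require Import complex.
From mathcomp Require Import zify ring lra.
From mathcomp Require mpoly.
(* Imported only where they are used: their notations hide [True] and [False]. *)
From mathcomp Require ordered_qelim qe_rcf.

Set Implicit Arguments.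
Unset Strict Implicit.
Unset Printing Implicit Defensive.

Import Order.TTheory GRing.Theory Num.Theory.
Import numFieldNormedType.Exports.

Local Open Scope classical_set_scope.
Local Open Scope ring_scope.

(** * Simple algebraic extensions *)

Section PrimitiveElement.
Variables (F K : fieldType) (iota : {rmorphism F -> K}).
Local Notation "p ^^" := (map_poly iota p) (at level 2).

Definition in_simple (z x : K) := exists h : {poly F}, h^^.[z] = x.

Lemma in_simple_trans z y x : in_simple z y -> in_simple y x -> in_simple z x.
Proof.
by move=> [g <-] [h <-]; exists (h \Po g); rewrite map_comp_poly horner_comp.
Qed.

Lemma primitive_element (s : seq K) : [pchar F] =i pred0 ->
  (forall x, x \in s -> algebraicOver iota x) ->
  exists2 z, algebraicOver iota z & forall x, x \in s -> in_simple z x.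
Proof.
move=> charF; elim: s => [|x s IH] algs.
  by exists 0 => //; exact: algebraic0.
have [y algy Hy] : exists2 z, algebraicOver iota z &
    forall x, x \in s -> in_simple z x.
  by apply: IH => t ts; apply: algs; rewrite inE ts orbT.
have algx : algebraicOver iota x by apply: algs; rewrite inE eqxx.
have [p nz_p px] := algx; have [q nz_q qy] := algy.
have [n [zx zy]] := pchar0_PET nz_p px nz_q qy charF.
exists (y *+ n - x).
  apply: algebraic_sub => //; rewrite -mulr_natr; apply: algebraic_mul => //.
  by rewrite -(rmorph_nat iota); exact: algebraic_id.
by move=> t; rewrite inE => /orP[/eqP->|/Hy /(in_simple_trans zy)].
Qed.

(* The remainders mod [q] of 1, h, ..., h ^ d lie in a space of dimension
   d = deg q, so a linear relation between them annihilates y = h(z). *)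
Lemma in_simple_bounded (z : K) (q : {poly F}) (y : K) :
  q != 0 -> root q^^ z -> in_simple z y ->
  exists a : {poly F}, [/\ a != 0, (size a <= size q)%N & root a^^ y].
Proof.
move=> nz_q qz [h hy].
have [d sz_q] : exists d, size q = d.+1.
  by exists (size q).-1; rewrite prednK // lt0n size_poly_eq0.
pose M : 'M[F]_(d.+1, d) := \matrix_i poly_rV (h ^+ i %% q).
have : kermx M != 0.
  by rewrite kermx_eq0 /row_free neq_ltn ltnS rank_leq_col.
case/rowV0Pn => v /sub_kermxP vM nz_v.
exists (rVpoly v); split.
- apply: contraNneq nz_v => v0.
  by rewrite -[v]rVpolyK v0 linear0.
- by rewrite sz_q; exact: size_poly.
have E : \sum_(i < d.+1) v 0 i *: (h ^+ i %% q) = 0.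
  have := congr1 rVpoly vM; rewrite linear0 mulmx_sum_row linear_sum /=;
    apply: etrans.
  apply: eq_bigr => i _; rewrite linearZ /= rowK poly_rV_K //.
  by rewrite -ltnS; have := ltn_modp (h ^+ i) q; rewrite nz_q sz_q.
have Ez i : (h ^+ i %% q)^^.[z] = y ^+ i.
  have := congr1 (fun p => p^^.[z]) (divp_eq (h ^+ i) q).
  rewrite /= rmorphD rmorphM hornerD hornerM (eqP qz) mulr0 add0r => <-.
  by rewrite rmorphXn horner_exp hy.
apply/rootP; have := congr1 (fun p => p^^.[z]) E; rewrite rmorph0 horner0;
  apply: etrans.
rewrite rmorph_sum horner_sum /rVpoly.
rewrite (horner_coef_wide _ (n := d.+1)); last first.
  by rewrite size_map_poly size_poly.
apply: eq_bigr => i _; rewrite coef_map /= map_polyZ hornerZ Ez /=.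
by rewrite coef_poly ltn_ord valK.
Qed.

Lemma in_simple_inv z y : algebraicOver iota z -> in_simple z y ->
  in_simple z y^-1.
Proof.
move=> [q nz_q qz] zy.
have [->|nz_y] := eqVneq y 0; first by exists 0; rewrite invr0 rmorph0 horner0.
have [a [nz_a _ ay]] := in_simple_bounded nz_q qz zy.
apply: in_simple_trans zy _.
have : algebraicOver iota y by exists a.
clear - nz_y nz_a ay => _.
have [n le_n] := ubnP (size a);
  elim: n a nz_a ay le_n => // n IH a nz_a ay le_n.
have [a0|nz_a0] := eqVneq a`_0 0.
  have /factor_theorem[b Eb] : root a 0 by rewrite /root horner_coef0 a0.
  rewrite subr0 in Eb.
  have nz_b : b != 0 by apply: contraNneq nz_a => b0; rewrite Eb b0 mul0r.
  apply: (IH b) => //.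
    by move: ay; rewrite Eb rmorphM rootM /= map_polyX rootX (negPf nz_y) orbF.
  by move: le_n; rewrite Eb size_mulX.
have /factor_theorem[b Eb] : root (a - (a`_0)%:P) 0.
  by rewrite /root hornerD hornerN hornerC horner_coef0 subrr.
rewrite subr0 in Eb; exists (- (a`_0)^-1 *: b).
rewrite map_polyZ hornerZ; apply: (mulIf nz_y); rewrite mulVf //.
have : (a - (a`_0)%:P)^^.[y] = b^^.[y] * y
  by rewrite Eb rmorphM hornerM /= map_polyX hornerX.
rewrite rmorphB hornerD hornerN /= map_polyC hornerC (eqP ay) sub0r -mulrA =>
  <-.
by rewrite /= rmorphN fmorphV mulrNN mulVf // fmorph_eq0.
Qed.

End PrimitiveElement.

Section RationalSubfield.
Variables (R K : fieldType) (iota : {rmorphism R -> K}) (s : K).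

Definition at_s (p : {poly R}) : K := (map_poly iota p).[s].

Lemma at_s_is_zmod_morphism : zmod_morphism at_s.
Proof. by move=> p q; rewrite /at_s rmorphB hornerD hornerN. Qed.
HB.instance Definition _ := GRing.isZmodMorphism.Build _ _ at_s
  at_s_is_zmod_morphism.
Lemma at_s_is_monoid_morphism : monoid_morphism at_s.
Proof. by split; [rewrite /at_s rmorph1 hornerC|move=> p q;
  rewrite /at_s rmorphM hornerM]. Qed.
HB.instance Definition _ := GRing.isMonoidMorphism.Build _ _ at_s
  at_s_is_monoid_morphism.

Definition rational_in : {pred K} := fun x =>
  `[< exists2 pq : {poly R} * {poly R}, at_s pq.2 != 0 &
    x = at_s pq.1 / at_s pq.2 >].

Lemma rational_inP x : reflect
  (exists2 pq : {poly R} * {poly R}, at_s pq.2 != 0 & x = at_s pq.1 / at_s pq.2)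
  (x \in rational_in).
Proof. exact: asboolP. Qed.

Lemma rational_in_poly p : at_s p \in rational_in.
Proof. by apply/rational_inP; exists (p, 1);
  rewrite /= rmorph1 ?oner_neq0 ?divr1. Qed.

Lemma rational_in_divring : divring_closed rational_in.
Proof.
split.
- by apply/rational_inP; exists (1, 1); rewrite /= rmorph1 ?oner_neq0 ?divr1.
- move=> _ _ /rational_inP[[p q] /= nz_q ->] /rational_inP[[p' q'] /= nz_q' ->].
  apply/rational_inP; exists (p * q' - p' * q, q * q'); rewrite /= ?rmorphM.
    by rewrite mulf_neq0.
  by rewrite rmorphB /= !rmorphM /=; field; rewrite nz_q nz_q'.
- move=> _ _ /rational_inP[[p q] /= nz_q ->] /rational_inP[[p' q'] /= nz_q' ->].
  have [E|nz_p'] := eqVneq (at_s p') 0.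
    apply/rational_inP; exists (0, 1); rewrite /= ?rmorph1 ?oner_neq0 //.
    by rewrite E rmorph0 !mul0r invr0 mulr0.
  apply/rational_inP; exists (p * q', q * p'); rewrite /= ?rmorphM.
    by rewrite mulf_neq0.
  by field; rewrite nz_q nz_q' nz_p'.
Qed.

HB.instance Definition _ := GRing.isDivringClosed.Build K rational_in
  rational_in_divring.

Record ratsub := Ratsub { ratsub_val :> K; _ : ratsub_val \in rational_in }.
HB.instance Definition _ := [isSub for ratsub_val].
HB.instance Definition _ := [Choice of ratsub by <:].
HB.instance Definition _ := [SubChoice_isSubComUnitRing of ratsub by <:].
HB.instance Definition _ := [SubComUnitRing_isSubIntegralDomain of ratsub
  by <:].
HB.instance Definition _ := [SubIntegralDomain_isSubField of ratsub by <:].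

Definition ratsub_mor : {rmorphism ratsub -> K} := val.

End RationalSubfield.

(** * Fields with a place *)

Definition laurent_eval (R : Type) (K : unitRingType) (phi : R -> K)
  (l : seq (R * int)) (x : K) : K := \sum_(cm <- l) phi cm.1 * x ^ cm.2.

Section Place.
Variables (R K : fieldType) (iota : {rmorphism R -> K}) (plim : K -> R -> Prop).
Hypothesis plimD : forall x y a b, plim x a -> plim y b -> plim (x + y) (a + b).
Hypothesis plimM : forall x y a b, plim x a -> plim y b -> plim (x * y) (a * b).
Hypothesis plimC : forall c, plim (iota c) c.
Hypothesis plim_unique : forall x a b, plim x a -> plim x b -> a = b.
Hypothesis placeP : forall x, (exists c, plim x c) \/ plim x^-1 0.

Lemma plim0 : plim 0 0.
Proof. by rewrite -(rmorph0 iota). Qed.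

Lemma plim1 : plim 1 1.
Proof. by rewrite -(rmorph1 iota). Qed.

Lemma plimX x a n : plim x a -> plim (x ^+ n) (a ^+ n).
Proof.
move=> xa; elim: n => [|n IH]; first by rewrite !expr0; exact: plim1.
by rewrite !exprS; exact: plimM.
Qed.

Lemma plim_inv0 x c : plim x^-1 0 -> plim x c -> x = 0.
Proof.
move=> xV xc; apply/eqP; apply: contraT => nz_x.
have : plim 1 0 by rewrite -(mulVf nz_x) -(mul0r c); exact: plimM.
by move/(plim_unique plim1)/eqP; rewrite oner_eq0.
Qed.

Lemma plimV x a : a != 0 -> plim x a -> plim x^-1 a^-1.
Proof.
move=> nz_a xa.
have nz_x : x != 0.
  by apply: contraNneq nz_a => x0;
    rewrite (plim_unique xa (a := a) (b := 0)) // x0; exact: plim0.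
have [[c xc]|xV] := placeP x^-1; last first.
  by rewrite invrK in xV; move: nz_a; rewrite (plim_unique xa xV) eqxx.
have : plim 1 (c * a) by rewrite -(mulVf nz_x); exact: plimM.
by move/(plim_unique plim1) => ca; rewrite -[a^-1]mul1r ca mulfK.
Qed.

(* [x] and [y] have the same order of magnitude; in particular both are nonzero
   (if [y = 0] then [x / y = 0]). *)
Definition asy x y := exists2 c, c != 0 & plim (x / y) c.

Lemma asy_neq0 x y : asy x y -> x != 0 /\ y != 0.
Proof.
move=> [c nz_c xc]; split; apply: contraNneq nz_c => E;
  by apply/eqP; apply: plim_unique xc _; rewrite E ?invr0 ?mulr0 ?mul0r;
    exact: plim0.
Qed.

Lemma asy_refl x : x != 0 -> asy x x.
Proof. by move=> nz_x; exists 1; [exact: oner_neq0|rewrite divff //;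
  exact: plim1]. Qed.

Lemma asy_sym x y : asy x y -> asy y x.
Proof.
move=> [c nz_c xc]; exists c^-1; first by rewrite invr_eq0.
by rewrite -[y / x]invrK invf_div; exact: plimV.
Qed.

Lemma asyM x x' y y' : asy x y -> asy x' y' -> asy (x * x') (y * y').
Proof.
move=> [c nz_c xc] [c' nz_c' xc']; exists (c * c'); first by rewrite mulf_neq0.
by rewrite -mulf_div; exact: plimM.
Qed.

Lemma asyV x y : asy x y -> asy x^-1 y^-1.
Proof. by move=> /asy_sym [c nz_c yc]; exists c => //; rewrite invrK mulrC. Qed.

Lemma asy_trans y x z : asy x y -> asy y z -> asy x z.
Proof.
move=> xy yz; have [_ nz_y] := asy_neq0 xy.
move: xy yz => [c nz_c xc] [c' nz_c' xc']; exists (c * c');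
  first by rewrite mulf_neq0.
have -> : x / z = (x / y) * (y / z) by rewrite mulrA divfK.
exact: plimM.
Qed.

Lemma asyX x y n : asy x y -> asy (x ^+ n) (y ^+ n).
Proof.
move=> xy; elim: n => [|n IH]; first by rewrite !expr0; apply: asy_refl;
  exact: oner_neq0.
by rewrite !exprS; exact: asyM.
Qed.

Lemma asyXz x y (n : int) : asy x y -> asy (x ^ n) (y ^ n).
Proof.
by move=> xy; case: n => n; [exact: asyX|apply: asyV; exact: asyX].
Qed.

Lemma asyD x y : x != 0 -> plim (y / x) 0 -> asy (x + y) x.
Proof.
move=> nz_x yx; exists 1; first exact: oner_neq0.
by rewrite mulrDl divff // -[X in plim _ X]addr0; apply: plimD => //;
  exact: plim1.
Qed.

Lemma asy_trichotomy x y : x != 0 -> y != 0 ->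
  [\/ asy x y, plim (x / y) 0 | plim (y / x) 0].
Proof.
move=> nz_x nz_y; have [[c xc]|] := placeP (x / y); last by rewrite invf_div;
  constructor 3.
by have [E|nz_c] := eqVneq c 0; [rewrite E in xc; constructor 2|constructor 1;
  exists c].
Qed.

(* A sum of terms of pairwise different orders of magnitude is of the order of
   one of its terms, so it does not vanish unless all the terms do. *)
Lemma sum_asy (t : nat -> K) n :
  (forall i j, (i < j < n)%N -> ~ asy (t i) (t j)) ->
  (forall i, (i < n)%N -> t i = 0) \/
  exists2 i, (i < n)%N & asy (\sum_(i < n) t i) (t i).
Proof.
elim: n => [|n IH] H; first by left.
rewrite big_ord_recr /=.
have [|t0|[i lt_in Hi]] := IH.
- by move=> i j /andP[ij jn]; apply: H; rewrite ij ltnS ltnW.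
- rewrite big1 ?add0r => [|i _]; last exact: t0.
  have [E|nz_t] := eqVneq (t n) 0; last by right; exists n => //;
    exact: asy_refl.
  left => i; rewrite ltnS leq_eqVlt => /orP[/eqP->//|]; exact: t0.
right; have [E|nz_t] := eqVneq (t n) 0.
  by exists i; [exact: ltnW|rewrite E addr0].
have [nz_s nz_i] := asy_neq0 Hi.
have [st|st|st] := asy_trichotomy nz_s nz_t.
- by case: (H i n); [rewrite lt_in ltnSn|exact: asy_trans (asy_sym Hi) st].
- by exists n => //; rewrite addrC; exact: asyD.
- by exists i; [exact: ltnW|apply: asy_trans Hi; exact: asyD].
Qed.

Variable s : K.
Hypothesis s_infinite : plim s^-1 0.
Hypothesis s_neq0 : s != 0.

Lemma plim_sX n : (0 < n)%N -> plim (s ^- n) 0.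
Proof.
case: n => [//|n] _; have := plimX n.+1 s_infinite; by rewrite expr0n exprVn.
Qed.

Lemma asy_poly (p : {poly R}) : p != 0 ->
  exists d : nat, asy (map_poly iota p).[s] (s ^+ d).
Proof.
elim/poly_ind: p => [|p c IH]; first by rewrite eqxx.
rewrite rmorphD rmorphM /= map_polyX map_polyC /= hornerMXaddC.
have [->|nz_p] := eqVneq p 0.
  rewrite mul0r add0r polyC_eq0 => nz_c; exists 0%N.
  by rewrite rmorph0 horner0 mul0r add0r expr0; exists c => //; rewrite divr1.
have [d Hd] := IH nz_p => _; exists d.+1.
have H : asy ((map_poly iota p).[s] * s) (s ^+ d.+1).
  by rewrite exprSr; apply: asyM => //; exact: asy_refl.
apply: asy_trans (H); apply: asyD; first by have [] := asy_neq0 H.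
have [e nz_e He] := asy_sym H; rewrite -(mulr0 c).
have -> : iota c / ((map_poly iota p).[s] * s) =
   iota c * (s ^- d.+1 * (s ^+ d.+1 / ((map_poly iota p).[s] * s))).
  by rewrite [s ^- _ * _]mulrA mulVf ?mul1r // expf_neq0.
by apply: plimM => //; rewrite -(mul0r e); apply: plimM => //; exact: plim_sX.
Qed.

Lemma s_exp_asy (b c : int) : asy (s ^ b) (s ^ c) -> b = c.
Proof.
wlog le_bc : b c / b <= c => [H A|].
  by have [/H->//|/ltW le_cb] := leP b c; apply/esym/H => //; exact: asy_sym.
move=> [e nz_e He]; apply/eqP; apply: contraNT nz_e => /eqP ne_bc.
have [n lt_n E] : exists2 n : nat, (0 < n)%N & c = b + n%:Z.
  by exists `|c - b|%N; lia.
apply/eqP; apply: plim_unique He _.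
rewrite E expfzDr // invfM mulrA divff ?expfz_neq0 // mul1r.
exact: plim_sX.
Qed.

Section Expansion.
Variables (S : K -> Prop) (N : nat).
Hypothesis SB : forall x y, S x -> S y -> S (x - y).
Hypothesis SM : forall x y, S x -> S y -> S (x * y).
Hypothesis SV : forall x, S x -> S x^-1.
Hypothesis SC : forall c, S (iota c).
Hypothesis Ss : S s.
Hypothesis N_gt0 : (0 < N)%N.

(* The order of [y] relative to [s], multiplied by a common denominator [N]. *)
Definition order_at y (b : int) := asy (y ^+ N) (s ^ b).

Hypothesis orderP : forall y, S y -> y != 0 -> exists b, order_at y b.

Lemma order_atM x y b c : order_at x b -> order_at y c ->
  order_at (x * y) (b + c).
Proof. by move=> xb yc; rewrite /order_at exprMn expfzDr //; exact: asyM. Qed.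

Lemma order_atV x b : order_at x b -> order_at x^-1 (- b).
Proof. by move=> xb; rewrite /order_at exprVn -invr_expz; exact: asyV. Qed.

Lemma order_atXz x b (n : int) : order_at x b -> order_at (x ^ n) (b * n).
Proof.
move=> xb; rewrite /order_at -exprz_exp.
have -> : (x ^ n) ^+ N = (x ^+ N) ^ n.
  by rewrite -[LHS]/((x ^ n) ^ N%:Z) -[x ^+ N]/(x ^ N%:Z) !exprz_exp mulrC.
exact: asyXz.
Qed.

Lemma order_at_neq0 x b : order_at x b -> x != 0.
Proof.
by move=> /asy_neq0[+ _]; rewrite expf_eq0 N_gt0.
Qed.

Lemma order_at_inj x b c : order_at x b -> order_at x c -> b = c.
Proof. by move=> xb xc; apply: s_exp_asy; exact: asy_trans (asy_sym xb) xc. Qed.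

Lemma order_at_s : order_at s N.
Proof. by apply: asy_refl; rewrite expf_neq0. Qed.

Lemma order_at_lt0 x b : order_at x b -> b < 0 -> plim x 0.
Proof.
move=> xb b_lt0; have nz_x := order_at_neq0 xb.
have [n n_gt0 En] : exists2 n : nat, (0 < n)%N & b = - n%:Z.
  by exists `|b|%N; lia.
have xN : plim (x ^+ N) 0.
  have [c nz_c Hc] := xb; rewrite -(mulr0 c).
  rewrite -[x ^+ N](divfK (expfz_neq0 b s_neq0)); apply: plimM => //.
  by rewrite En -exprnN; exact: plim_sX.
have [[c xc]|xV] := placeP x.
  have := plim_unique (plimX N xc) xN => /eqP.
  by rewrite expf_eq0 N_gt0 /= => /eqP c0; rewrite -c0.
have := plimX N xV; rewrite exprVn expr0n gtn_eqF //= => H.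
have /eqP := plim_inv0 H xN; by rewrite expf_eq0 N_gt0 (negPf nz_x).
Qed.

Lemma order_at0 x : order_at x 0 -> exists2 c, c != 0 & plim x c.
Proof.
move=> [e nz_e]; rewrite expr0z divr1 => xe.
have [[c xc]|xV] := placeP x.
  exists c => //; apply: contraNneq nz_e => c0.
  have := plim_unique (plimX N xc) xe => <-.
  by rewrite c0 expr0n gtn_eqF.
have := plimX N xV; rewrite exprVn expr0n gtn_eqF //= => H.
have x0 := plim_inv0 H xe.
by move: nz_e; rewrite (plim_unique xe (b := 0)) ?eqxx // x0; exact: plim0.
Qed.

Lemma order_at_plim0 x b : order_at x b -> plim x 0 -> b < 0.
Proof.
move=> xb x0; have [//|b_gt0|b0] := ltrgtP b 0.
- have := order_at_lt0 (order_atV xb); rewrite oppr_lt0 => /(_ b_gt0) H.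
  by have := order_at_neq0 xb; rewrite (plim_inv0 H x0) eqxx.
- rewrite b0 in xb; have [c nz_c xc] := order_at0 xb.
  by move: nz_c; rewrite (plim_unique xc x0) eqxx.
Qed.

Lemma SX x (n : int) : S x -> S (x ^ n).
Proof.
have S1 : S 1 by rewrite -(rmorph1 iota).
have SXn m : S x -> S (x ^+ m).
  by move=> Sx; elim: m => [|m IH]; rewrite ?expr0 ?exprS //; exact: SM.
by case: n => n Sx; [exact: SXn|apply: SV; exact: SXn].
Qed.

(* The orders of the nonzero elements of [S] form a nonzero subgroup of the
   integers; [u] realizes its positive generator. *)
Lemma uniformizer : exists u (g : int), [/\ S u, 0 < g, order_at u g &
  forall y, S y -> y != 0 -> exists m : int, order_at y (g * m)].
Proof.
pose P (n : nat) := `[< (0 < n)%N /\ exists2 u, S u & order_at u n >].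
have exP : exists n, P n by exists N; apply/asboolP; split=> //;
  exists s => //; exact: order_at_s.
case: (ex_minnP exP) => g /asboolP[g_gt0 [u Su ug]] gmin.
exists u, g; split => // y Sy nz_y; have [b yb] := orderP Sy nz_y.
exists (b %/ g)%Z; rewrite mulrC.
suff r0 : (b %% g)%Z = 0 by rewrite {1}(divz_eq b g) r0 addr0 in yb.
apply/eqP; apply: contraT => nz_r.
have r_ge0 : 0 <= (b %% g)%Z by apply: modz_ge0; lia.
have r_lt : (b %% g)%Z < g by apply: ltz_pmod; lia.
suff /gmin : P `|(b %% g)%Z|%N by lia.
apply/asboolP; split; first by lia.
exists (y * u ^ (- (b %/ g)%Z)); first by apply: SM => //; exact: SX.
have -> : `|(b %% g)%Z|%N = b + g%:Z * - (b %/ g)%Z :> int.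
  by rewrite gez0_abs // /modz mulrN [_ * g%:Z]mulrC.
by apply: order_atM => //; exact: order_atXz.
Qed.

(* Repeatedly subtract the leading term: [z / u ^ m] has a nonzero limit [c] for
   some [m], and passing from [z] to [z - c u ^ m] lowers the order. *)
Lemma laurent_expansion : exists2 u, u != 0 /\ plim u^-1 0 &
  forall y (M : nat), S y ->
  exists l, plim ((y - laurent_eval iota l u) * u ^+ M) 0.
Proof.
have [u [g [Su g_gt0 ug ordg]]] := uniformizer.
exists u.
  by split; [exact: order_at_neq0 ug|apply: order_at_lt0 (order_atV ug) _; lia].
move=> y M Sy.
suff H n z : S z -> (z != 0 -> exists2 b, order_at z b & b < n%:Z - M%:Z * g) ->
    exists l, plim ((z - laurent_eval iota l u) * u ^+ M) 0.
  have [->|nz_y] := eqVneq y 0.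
    by exists [::]; rewrite /laurent_eval big_nil subrr mul0r; exact: plim0.
  have [b yb] := orderP Sy nz_y.
  have [n ltn] : exists n : nat, b < n%:Z - M%:Z * g.
    by exists (absz (b + M%:Z * g + 1)); lia.
  by apply: (H n y Sy) => _; exists b.
elim: n z => [|n IH] z Sz Hz.
  exists [::]; rewrite /laurent_eval big_nil subr0.
  have [->|/Hz[b zb ltb]] := eqVneq z 0; first by rewrite mul0r; exact: plim0.
  apply: (@order_at_lt0 _ (b + g * M%:Z)); last by lia.
  by apply: order_atM => //; exact: (order_atXz M).
have [z0|nz_z] := eqVneq z 0.
  by exists [::]; rewrite z0 /laurent_eval big_nil subrr mul0r; exact: plim0.
have [b zb ltb] := Hz nz_z.
have [m zm] := ordg z Sz nz_z; have Eb := order_at_inj zb zm.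
have nz_u := order_at_neq0 ug.
have um : order_at (u ^ m) b by rewrite Eb; exact: order_atXz.
have z1 : order_at (z / u ^ m) 0.
  by rewrite -(subrr b); apply: order_atM => //; exact: order_atV.
have [c nz_c zc] := order_at0 z1.
have Sz' : S (z - iota c * u ^ m) by apply: SB => //; apply: SM => //;
  exact: SX.
have [|l Hl] := IH _ Sz'.
  move=> nz_z'; have [b' z'b'] := orderP Sz' nz_z'; exists b' => //.
  have : b' - b < 0.
    apply: (@order_at_plim0 ((z - iota c * u ^ m) / u ^ m)).
      by apply: order_atM => //; exact: order_atV.
    rewrite mulrBl mulfK ?expfz_neq0 // -(subrr c) -rmorphN.
    by apply: plimD => //; rewrite -rmorphN.
  lia.
exists ((c, m) :: l); move: Hl.
by rewrite /laurent_eval big_cons /= opprD addrA.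
Qed.

End Expansion.

Local Notation F := (ratsub iota s).
Local Notation val := (ratsub_mor iota s).

Lemma at_s_inj : injective (at_s iota s).
Proof.
apply: raddf_inj => p p0; apply/eqP; apply: contraT => /asy_poly[d].
by case/asy_neq0; rewrite -[_.[_]]/(at_s iota s p) p0 eqxx.
Qed.

Lemma rational_asy (x : F) : x != 0 -> exists b : int, asy (val x) (s ^ b).
Proof.
case: x => x xF nz_x; have /rational_inP[[p q] /= nz_q Ex] := xF.
have nz_p : at_s iota s p != 0.
  apply: contraNneq nz_x => p0; apply/eqP; apply: val_inj => /=.
  by rewrite Ex p0 mul0r.
have [d pd] : exists d : nat, asy (at_s iota s p) (s ^+ d).
  by apply: asy_poly; apply: contraNneq nz_p => ->; rewrite rmorph0.
have [e qe] : exists d : nat, asy (at_s iota s q) (s ^+ d).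
  by apply: asy_poly; apply: contraNneq nz_q => ->; rewrite rmorph0.
exists (d%:Z - e%:Z); rewrite /= Ex expfzDr // -invr_expz.
by apply: asyM => //; exact: asyV.
Qed.

Lemma root_asy (a : {poly F}) (y : K) : a != 0 -> root (map_poly val a) y ->
  y != 0 -> exists e (b : int), (0 < e < size a)%N /\ asy (y ^+ e) (s ^ b).
Proof.
move=> nz_a ay nz_y.
pose t i := val a`_i * y ^+ i.
have [[i [j [ij [jn tij]]]]|Ht] :=
  pselect (exists i j, (i < j)%N /\ (j < size a)%N /\ asy (t i) (t j)).
  have nz_c k : t k != 0 -> a`_k != 0.
    by apply: contraNneq; rewrite /t => ->; rewrite rmorph0 mul0r.
  have [/nz_c nz_i /nz_c nz_j] := asy_neq0 tij.
  have [b ib] := rational_asy nz_i; have [c jc] := rational_asy nz_j.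
  exists (j - i)%N, (b - c); split.
    by rewrite subn_gt0 ij (leq_ltn_trans _ jn) // leq_subr.
  have -> : y ^+ (j - i) = t j * (t i)^-1 * (val a`_i * (val a`_j)^-1).
    rewrite expfB // /t invfM.
    by field; rewrite !fmorph_eq0 nz_i nz_j expf_neq0.
  rewrite expfzDr // -invr_expz -[s ^ b * _]mul1r; apply: asyM.
    have [nz_ti nz_tj] := asy_neq0 tij.
    rewrite -(divff nz_ti); apply: asyM; first exact: asy_sym.
    by apply: asy_refl; rewrite invr_eq0.
  by apply: asyM => //; exact: asyV.
have [|t0|[i lt_i]] := sum_asy (t := t) (n := size a).
- by move=> i j /andP[ij jn] tij; apply: Ht; exists i, j.
- case/eqP: nz_a; apply/polyP => i; rewrite coef0.
  have [lt_i|ge_i] := ltnP i (size a); last exact: nth_default.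
  by move/eqP: (t0 i lt_i); rewrite mulf_eq0 expf_eq0
    (negPf nz_y) andbF orbF fmorph_eq0 => /eqP.
- move=> /asy_neq0[+ _]; have := rootP ay; rewrite horner_coef size_map_poly.
  under eq_bigr do rewrite coef_map.
  by move=> ->; rewrite eqxx.
Qed.

Lemma algebraic_expansion (xs : seq K) : [pchar R] =i pred0 ->
  (forall x, x \in xs -> algebraicOver val x) ->
  exists2 u, u != 0 /\ plim u^-1 0 & forall y (M : nat), y \in xs ->
    exists l, plim ((y - laurent_eval iota l u) * u ^+ M) 0.
Proof.
move=> charR algxs.
have charF : [pchar F] =i pred0.
  move=> p; rewrite -(fmorph_pchar val) -[RHS](charR p); exact: fmorph_pchar.
have [z algz Hz] := primitive_element charF algxs.
have [q nz_q qz] := algz.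
have SC (c : R) : in_simple val z (iota c).
  exists (Ratsub (rational_in_poly iota s c%:P))%:P.
  by rewrite map_polyC hornerC /= /at_s map_polyC hornerC.
have Ss : in_simple val z s.
  exists (Ratsub (rational_in_poly iota s 'X))%:P.
  by rewrite map_polyC hornerC /= /at_s map_polyX hornerX.
have [|||||||u u_inf Hu] := @laurent_expansion (in_simple val z) (size q)`!.
- by move=> _ _ [g <-] [h <-]; exists (g - h); rewrite rmorphB hornerD hornerN.
- by move=> _ _ [g <-] [h <-]; exists (g * h); rewrite rmorphM hornerM.
- by move=> x; exact: in_simple_inv.
- exact: SC.
- exact: Ss.
- exact: fact_gt0.
- move=> y Sy nz_y.
  have [a [nz_a sz_a ay]] := in_simple_bounded nz_q qz Sy.
  have [e [b [/andP[e_gt0 lt_e] yb]]] := root_asy nz_a ay nz_y.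
  have /dvdnP[k Ek] : (e %| (size q)`!)%N.
    by rewrite dvdn_fact // e_gt0 (leq_trans (ltnW lt_e)).
  exists (b * k%:Z); rewrite /order_at Ek mulnC exprM -exprz_exp.
  exact: asyX.
by exists u => // y M /Hz; exact: Hu.
Qed.

Lemma algebraic_over_rational (Q : {poly {poly R}}) (x : K) : Q != 0 ->
  (map_poly (at_s iota s) Q).[x] = 0 -> algebraicOver val x.
Proof.
move=> nz_Q Qx.
pose a := \poly_(j < size Q) Ratsub (rational_in_poly iota s Q`_j).
have Ea : map_poly val a = map_poly (at_s iota s) Q.
  apply/polyP => j; rewrite !coef_map coef_poly /=.
  by case: ltnP => // ?; rewrite nth_default // rmorph0.
exists a; last by rewrite /root Ea Qx.
apply: contraNneq (nz_Q) => a0.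
have := Ea; rewrite a0 rmorph0 => /esym/eqP.
by rewrite map_poly_eq0_id0 ?(raddf_eq0 _ at_s_inj) ?lead_coef_eq0 ?nz_Q.
Qed.

End Place.

(** * Ultrapowers of the reals *)

Section Ultrapower.
Variables (R : fieldType) (U : set_system nat) (UU : UltraFilter U).

Definition ultra_null (_ : UltraFilter U) : {pred (nat -> R)} :=
  fun g => `[< U [set k | g k = 0] >].

Lemma ultra_nullP (g : nat -> R) :
  reflect (U [set k | g k = 0]) (g \in ultra_null UU).
Proof. exact: asboolP. Qed.

Lemma ultra_null_ideal : idealr_closed (ultra_null UU).
Proof.
have PU := @ultra_proper _ _ UU.
split.
- by apply/ultra_nullP; apply: filterE.
- apply/ultra_nullP => H.
  have : U set0 by apply: filterS H => k /= /eqP; rewrite oner_eq0.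
  exact: filter_not_empty.
- move=> a u v /ultra_nullP Hu /ultra_nullP Hv; apply/ultra_nullP.
  apply: filterS2 Hu Hv => k /= ku kv.
  by rewrite -[LHS]/(a k * u k + v k) ku kv mulr0 addr0.
Qed.

HB.instance Definition _ := isIdealr.Build (nat -> R) (ultra_null UU)
  ultra_null_ideal.

Definition ultrapower : Type := {ideal_quot (ultra_null UU)}.

HB.instance Definition _ := GRing.ComNzRing.on ultrapower.
HB.instance Definition _ := Choice.on ultrapower.

Definition germ (g : nat -> R) : ultrapower :=
  (\pi_({ideal_quot (ultra_null UU)}) g)%qT.
Definition rep (x : ultrapower) : nat -> R :=
  repr (x : {ideal_quot (ultra_null UU)}).

Lemma repK x : germ (rep x) = x.
Proof. exact: reprK. Qed.

Lemma germP g h : germ g = germ h <-> U [set k | g k = h k].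
Proof.
have E : g \- h = g - h by [].
split=> [/eqP|H].
  rewrite -Quotient.idealrBE => /ultra_nullP.
  by apply: filterS => k /= /eqP; rewrite subr_eq0 => /eqP.
apply/eqP; rewrite -Quotient.idealrBE; apply/ultra_nullP.
by apply: filterS H => k /= E'; rewrite -[LHS]/(g k - h k) E' subrr.
Qed.

Lemma germ_is_zmod_morphism : zmod_morphism germ.
Proof. exact: rmorphB. Qed.
HB.instance Definition _ := GRing.isZmodMorphism.Build _ _ germ
  germ_is_zmod_morphism.
Lemma germ_is_monoid_morphism : monoid_morphism germ.
Proof. by split; [exact: rmorph1 | exact: rmorphM]. Qed.
HB.instance Definition _ := GRing.isMonoidMorphism.Build _ _ germ
  germ_is_monoid_morphism.

Definition ultrapower_inv (x : ultrapower) : ultrapower :=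
  germ (fun k => (rep x k)^-1).

Lemma ultrapower_mulVf (x : ultrapower) : x != 0 -> ultrapower_inv x * x = 1.
Proof.
move=> x0; rewrite -[X in _ * X]repK -rmorphM -(rmorph1 germ); apply/germP.
have [H|] := in_ultra_setVsetC [set k | rep x k = 0] UU; last first.
  by apply: filterS => k /= /eqP; exact: mulVf.
by case/eqP: x0; rewrite -[x]repK -(rmorph0 germ); apply/germP.
Qed.

Lemma ultrapower_inv0 : ultrapower_inv 0 = 0.
Proof.
rewrite -[RHS](rmorph0 germ); apply/germP.
have /germP : germ (rep 0) = germ 0 by rewrite repK rmorph0.
by apply: filterS => k /= ->; rewrite invr0.
Qed.

HB.instance Definition _ := GRing.ComNzRing_isField.Build ultrapower
  ultrapower_mulVf ultrapower_inv0.

End Ultrapower.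


Section Place.
Variables (R : realType) (U : set_system nat) (UU : UltraFilter U).
Local Notation K := (ultrapower R UU).

Definition ulim (x : K) (c : R) : Prop := rep x @ U --> c.

Lemma ulim_germ (g : nat -> R) (c : R) : ulim (germ UU g) c <-> g @ U --> c.
Proof.
have E : U [set k | rep (germ UU g) k = g k] by apply/germP; rewrite repK.
have E' : U [set k | g k = rep (germ UU g) k] by apply: filterS E.
by split=> H; apply: cvg_trans H; apply: near_eq_cvg.
Qed.

Lemma ulimD x y a b : ulim x a -> ulim y b -> ulim (x + y) (a + b).
Proof.
move=> xa yb; rewrite -[x]repK -[y]repK -rmorphD ulim_germ.
exact: (cvgD xa yb).
Qed.

Lemma ulimM x y a b : ulim x a -> ulim y b -> ulim (x * y) (a * b).
Proof.
move=> xa yb; rewrite -[x]repK -[y]repK -rmorphM ulim_germ.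
exact: (cvgM xa yb).
Qed.

Definition gcst (c : R) : K := germ UU (cst c).

Lemma gcst_is_zmod_morphism : zmod_morphism gcst.
Proof. by move=> a b; rewrite /gcst -rmorphB. Qed.
HB.instance Definition _ := GRing.isZmodMorphism.Build _ _ gcst
  gcst_is_zmod_morphism.
Lemma gcst_is_monoid_morphism : monoid_morphism gcst.
Proof. by split; [rewrite /gcst -(rmorph1 (germ UU))|move=> a b;
  rewrite /gcst -rmorphM]. Qed.
HB.instance Definition _ := GRing.isMonoidMorphism.Build _ _ gcst
  gcst_is_monoid_morphism.

Lemma ulimC c : ulim (gcst c) c.
Proof. by rewrite ulim_germ; exact: cvg_cst. Qed.

Lemma ulim_unique x a b : ulim x a -> ulim x b -> a = b.
Proof. by move=> xa xb; apply: (@cvg_unique _ _ (rep x @ U)). Qed.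

Lemma germV (g : nat -> R) : germ UU (fun k => (g k)^-1) = (germ UU g)^-1.
Proof.
have E : U [set k | rep (germ UU g) k = g k] by apply/germP; rewrite repK.
rewrite -[RHS]/(ultrapower_inv (germ UU g)).
by apply/germP; apply: filterS E => k /= ->.
Qed.

Lemma ulimV x a : a != 0 -> ulim x a -> ulim x^-1 a^-1.
Proof.
move=> a0 xa; rewrite -[x]repK -germV ulim_germ.
exact: cvgV.
Qed.

Lemma ulim_bounded x : U [set k | `|rep x k| <= 1] -> exists c, ulim x c.
Proof.
move=> xb.
have [c [_ Hc]] : `[-1, 1]%classic `&` cluster (rep x @ U) !=set0.
  apply: (@segment_compact R); rewrite /fmap /=; apply: filterS xb => k /=.
  rewrite in_itv /=. by rewrite ler_norml.
exists c => A cA; have [//|NA] := in_ultra_setVsetC (rep x @^-1` A) UU.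
have [y []] := Hc (~` A) A NA cA.
by [].
Qed.

Lemma ultrapower_placeP x : (exists c, ulim x c) \/ ulim x^-1 0.
Proof.
have [|H] := in_ultra_setVsetC [set k | `|rep x k| <= 1] UU.
  by move/ulim_bounded; left.
have [c Hc] : exists c, ulim x^-1 c.
  apply: ulim_bounded; have : U [set k | rep x^-1 k = (rep x k)^-1].
    by apply/germP; rewrite repK germV repK.
  move/filterS2: H; apply=> k /= /negP; rewrite -ltNge => xk ->.
  rewrite normrV ?unitfE -?normr_gt0 ?invf_le1 ?(ltW xk) //;
   exact: lt_trans ltr01 xk.
have [c0|c0] := eqVneq c 0; first by right; rewrite -c0.
by left; exists c^-1; rewrite -[x]invrK; exact: ulimV.
Qed.

End Place.

Section Sequences.
Variable (R : realType) (U : set_system nat) (UU : UltraFilter U).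
Local Notation K := (ultrapower R UU).

Lemma germ_sum (I : Type) (r : seq I) (g : I -> nat -> R) :
  germ UU (fun k => \sum_(i <- r) g i k) = \sum_(i <- r) germ UU (g i).
Proof. by rewrite -rmorph_sum; congr germ; apply/funext => k; rewrite fct_sumE.
Qed.

Lemma germX (g : nat -> R) (n : nat) : germ UU (fun k =>
  g k ^+ n) = germ UU g ^+ n.
Proof.
elim: n => [|n IH].
  by rewrite expr0 -(rmorph1 (germ UU)).
by rewrite exprS -IH -rmorphM; congr germ; apply/funext => k; rewrite exprS.
Qed.

Lemma germXz (g : nat -> R) (n : int) : germ UU (fun k =>
  g k ^ n) = germ UU g ^ n.
Proof. by case: n => n; rewrite ?germX // germV germX. Qed.

Lemma germZ c (g : nat -> R) : germ UU (fun k =>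
  c * g k) = gcst UU c * germ UU g.
Proof. by rewrite /gcst -rmorphM. Qed.

Lemma germ_laurent (l : seq (R * int)) (g : nat -> R) :
  germ UU (fun k => laurent_eval id l (g k)) =
    laurent_eval (gcst UU) l (germ UU g).
Proof.
rewrite /laurent_eval germ_sum; apply: eq_bigr => i _.
by rewrite germZ germXz.
Qed.

Lemma germ_horner (p : {poly R}) (g : nat -> R) :
  germ UU (fun k => p.[g k]) = (map_poly (gcst UU) p).[germ UU g].
Proof.
rewrite horner_coef size_map_poly.
transitivity (germ UU (fun k => \sum_(i < size p) p`_i * g k ^+ i)).
  by congr germ; apply/funext => k; rewrite horner_coef.
rewrite germ_sum; apply: eq_bigr => i _.
by rewrite coef_map germZ germX.
Qed.

Lemma germ_horner2 (Q : {poly {poly R}}) (s g : nat -> R) :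
  germ UU (fun k => Q.[(g k)%:P].[s k]) =
  (map_poly (at_s (gcst UU) (germ UU s)) Q).[germ UU g].
Proof.
transitivity (germ UU (fun k => \sum_(i < size Q) (Q`_i).[s k] * g k ^+ i)).
  congr germ; apply/funext => k; rewrite [Q.[_]]horner_coef horner_sum.
  by apply: eq_bigr => i _; rewrite -rmorphXn hornerM hornerC.
rewrite germ_sum (horner_coef_wide _ (size_poly _ _)); apply: eq_bigr => i _.
by rewrite coef_map /= /at_s -germ_horner -germX -rmorphM.
Qed.

End Sequences.

Lemma algebraic_sequence_expansion (R : realType) (m : nat)
    (x : nat -> 'I_m -> R) (Q : 'I_m -> {poly {poly R}}) :
  (forall i, Q i != 0) ->
  (forall i k, (Q i).[(x k i)%:P].[k.+1%:R] = 0) ->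
  exists (U : set_system nat) (u : nat -> R),
  [/\ UltraFilter U, \oo `<=` U, forall A, U [set k | A < `|u k|] &
   forall M : nat, exists l : 'I_m -> seq (R * int), forall i,
     (x k i - laurent_eval id (l i) (u k)) * u k ^+ M @[k --> U] --> 0].
Proof.
move=> nz_Q Qx.
have [U [UU ooU]] := @ultraFilterLemma nat \oo _.
pose s : nat -> R := fun k => k.+1%:R.
have s_inf : ulim (germ UU s)^-1 0.
  rewrite -germV; apply/ulim_germ.
  have := @cvg_harmonic R; apply: cvg_trans; exact: cvg_app.
have nz_s : germ UU s != 0.
  apply/eqP; rewrite -(rmorph0 (germ UU)) => /germP H.
  have /filter_ex[k /eqP] := H.
  by rewrite /s pnatr_eq0.
have algx (y : ultrapower R UU) : y \in [seq germ UU
  (x^~ i) | i <- enum 'I_m] ->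
    algebraicOver (ratsub_mor (gcst UU) (germ UU s)) y.
  case/mapP => i _ ->.
  have H := algebraic_over_rational (@ulimD _ _ UU) (@ulimM _ _ UU)
    (@ulimC _ _ UU)
   (@ulim_unique _ _ UU) (@ultrapower_placeP _ _ UU) s_inf nz_s (nz_Q i).
  apply: H; rewrite -germ_horner2 -(rmorph0 (germ UU)); congr germ.
  by apply/funext => k; exact: Qx.
have [|u [nz_u u_inf] Hu] :=
  algebraic_expansion (@ulimD _ _ UU) (@ulimM _ _ UU) (@ulimC _ _ UU)
   (@ulim_unique _ _ UU) (@ultrapower_placeP _ _ UU) s_inf nz_s _ algx.
  exact: pchar_num.
exists U, (rep u); split => //.
  move=> A; have A0 : 0 < (`|A| + 1)^-1 by rewrite invr_gt0 ltr_pwDr.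
  have {}u_inf : (rep u k)^-1 @[k --> U] --> 0 by apply/ulim_germ;
    rewrite germV repK.
  have [u0|] := in_ultra_setVsetC [set k | rep u k = 0] UU.
    by case/eqP: nz_u; rewrite -[u]repK -(rmorph0 (germ UU)); apply/germP.
  have H : U [set k | `|(rep u k)^-1| < (`|A| + 1)^-1].
    exact: (cvgr0_norm_lt _ u_inf _ A0).
  move=> Hn; apply: filterS2 H Hn => k /= + /eqP nz_k.
  rewrite normfV ltf_pV2 ?posrE ?normr_gt0 // ?ltr_pwDr //.
  by apply: le_lt_trans; rewrite (le_trans (ler_norm A)) // lerDl.
move=> M.
have /choice[l Hl] : forall i, exists l : seq (R * int),
   (x k i - laurent_eval id l (rep u k)) * rep u k ^+ M @[k --> U] --> 0.
  move=> i; have [|l Hl] := Hu (germ UU (x^~ i)) M.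
    by apply/mapP; exists i; rewrite ?mem_enum.
  exists l; apply/ulim_germ; move: Hl.
  by rewrite -{1 2}[u]repK -germ_laurent -rmorphB -germX -rmorphM.
by exists l.
Qed.

(** * Semialgebraic sets *)

Section Semialgebraic.
Import ordered_qelim qe_rcf.
Variable R : realType.
Local Notation env := (nat -> R).

Inductive polyfun : (env -> R) -> Prop :=
| polyfun_cst c : polyfun (fun=> c)
| polyfun_var i : polyfun (fun e => e i)
| polyfunD g h : polyfun g -> polyfun h -> polyfun (fun e => g e + h e)
| polyfunM g h : polyfun g -> polyfun h -> polyfun (fun e => g e * h e).

Inductive semialg : (env -> Prop) -> Prop :=
| semialg_le0 g : polyfun g -> semialg (fun e => g e <= 0)
| semialg_and P Q : semialg P -> semialg Q -> semialg (fun e => P e /\ Q e)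
| semialg_not P : semialg P -> semialg (fun e => ~ P e).

Lemma polyfun_comp g (h : env -> env) : polyfun g ->
  (forall i, polyfun (fun e => h e i)) -> polyfun (fun e => g (h e)).
Proof. by move=> pg ph; elim: pg => *; by [constructor | exact: ph]. Qed.

Lemma semialg_comp P (h : env -> env) : semialg P ->
  (forall i, polyfun (fun e => h e i)) -> semialg (fun e => P (h e)).
Proof.
move=> sP ph; elim: sP => [g pg|P1 Q1 _ IH1 _ IH2|P1 _ IH].
- by constructor; exact: polyfun_comp.
- exact: (semialg_and IH1 IH2).
- exact: (semialg_not IH).
Qed.

Lemma polyfunN g : polyfun g -> polyfun (fun e => - g e).
Proof.
move=> pg; have -> : (fun e => - g e) = (fun e => -1 * g e).
  by apply/funext => e; rewrite mulN1r.
by apply: polyfunM => //; exact: polyfun_cst.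
Qed.

Lemma polyfunX g n : polyfun g -> polyfun (fun e => g e ^+ n).
Proof.
move=> pg; elim: n => [|n IH]; first exact: polyfun_cst.
have -> : (fun e => g e ^+ n.+1) = (fun e => g e * g e ^+ n).
  by apply/funext => e; rewrite exprS.
exact: polyfunM.
Qed.

Lemma polyfun_sum (I : Type) (r : seq I) (g : I -> env -> R) :
  (forall i, polyfun (g i)) -> polyfun (fun e => \sum_(i <- r) g i e).
Proof.
move=> pg; elim: r => [|i r IH].
  by have -> : (fun e => \sum_(i <- [::]) g i e) = (fun=> 0);
    [apply/funext => e; rewrite big_nil|exact: polyfun_cst].
have -> : (fun e => \sum_(j <- i :: r) g j e) =
   (fun e => g i e + \sum_(j <- r) g j e).
  by apply/funext => e; rewrite big_cons.
exact: polyfunD.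
Qed.

Lemma semialg_ext P Q : (forall e, P e <-> Q e) -> semialg P -> semialg Q.
Proof. by move=> PQ; have -> : P = Q by apply/funext => e; exact/propext/PQ.
Qed.

Lemma semialg_le g h : polyfun g -> polyfun h -> semialg (fun e => g e <= h e).
Proof.
move=> pg ph; apply: semialg_ext (semialg_le0 (polyfunD pg (polyfunN ph))).
by move=> e; rewrite subr_le0.
Qed.

Lemma semialg_lt g h : polyfun g -> polyfun h -> semialg (fun e => g e < h e).
Proof.
move=> pg ph; apply: semialg_ext (semialg_not (semialg_le ph pg)).
by move=> e; rewrite ltNge; split => /negP.
Qed.

Lemma semialg_eq g h : polyfun g -> polyfun h -> semialg (fun e => g e = h e).
Proof.
move=> pg ph; apply: semialg_ext (semialg_and (semialg_le pg ph)
  (semialg_le ph pg)).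
by move=> e; split=> [[gh hg]|->//]; apply/eqP; rewrite eq_le gh.
Qed.

Lemma semialg_or P Q : semialg P -> semialg Q -> semialg (fun e => P e \/ Q e).
Proof.
move=> sP sQ; apply: semialg_ext
  (semialg_not (semialg_and (semialg_not sP) (semialg_not sQ))).
by move=> e; have [] := EM (P e); have [] := EM (Q e); tauto.
Qed.

Lemma semialg_imply P Q : semialg P -> semialg Q -> semialg (fun e => P e ->
  Q e).
Proof.
move=> sP sQ; apply: semialg_ext (semialg_not (semialg_and sP
  (semialg_not sQ))).
by move=> e; have [] := EM (P e); have [] := EM (Q e); tauto.
Qed.

Lemma semialg_true : semialg (fun=> Logic.True).
Proof.
by apply: semialg_ext (semialg_le0 (polyfun_cst 0)) => e; rewrite lexx.
Qed.

Lemma polyfun_term g : polyfun g ->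
  exists2 t : GRing.term R, GRing.rterm t &
    forall e, GRing.eval e t = g (nth 0 e).
Proof.
elim=> [c|i|g1 h1 _ [t rt Et] _ [u ru Eu]|g1 h1 _ [t rt Et] _ [u ru Eu]].
- by exists (GRing.Const c).
- by exists (GRing.Var _ i).
- by exists (GRing.Add t u) => /= [|e]; rewrite ?rt ?ru ?Et ?Eu.
- by exists (GRing.Mul t u) => /= [|e]; rewrite ?rt ?ru ?Et ?Eu.
Qed.

Lemma term_polyfun (t : GRing.term R) : GRing.rterm t ->
  exists2 g, polyfun g & forall e, GRing.eval e t = g (nth 0 e).
Proof.
elim: t => //= [i _|c _|n _|t IH u IHu|t IH|t IH n|t IH u IHu|t IH n].
- by exists (fun e => e i) => //; constructor.
- by exists (fun=> c) => //; constructor.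
- by exists (fun=> n%:R) => //; constructor.
- move=> /andP[/IH[g pg Eg] /IHu[h ph Eh]].
  by exists (fun e => g e + h e) => [|e]; [constructor|rewrite Eg Eh].
- move=> /IH[g pg Eg].
  by exists (fun e => - g e) => [|e]; [exact: polyfunN|rewrite Eg].
- move=> /IH[g pg Eg].
  exists (fun e => g e * n%:R) => [|e]; last by rewrite Eg mulr_natr.
  by apply: polyfunM => //; constructor.
- move=> /andP[/IH[g pg Eg] /IHu[h ph Eh]].
  by exists (fun e => g e * h e) => [|e]; [constructor|rewrite Eg Eh].
- move=> /IH[g pg Eg].
  by exists (fun e => g e ^+ n) => [|e]; [exact: polyfunX|rewrite Eg].
Qed.

Lemma semialg_formula P : semialg P ->
  exists2 f : ord.formula R, ord.rformula f &
    forall e, ord.holds e f <-> P (nth 0 e).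
Proof.
elim=> [g /polyfun_term[t rt Et]|P1 Q1 _ [f rf Ef] _ [h rh Eh]|P1 _ [f rf Ef]].
- exists (ord.Le t (GRing.NatConst _ 0)); rewrite /= ?rt // => e.
  by rewrite Et.
- by exists (ord.And f h); rewrite /= ?rf ?rh // => e; rewrite Ef Eh.
- by exists (ord.Not f) => //= e; rewrite Ef.
Qed.

Lemma formula_semialg (f : ord.formula R) : ord.qf_form f -> ord.rformula f ->
  exists2 P, semialg P & forall e, ord.holds e f <-> P (nth 0 e).
Proof.
elim: f => //=.
- move=> b _ _; exists (fun=> b) => //.
  case: b; first by apply: semialg_ext semialg_true => e.
  by apply: semialg_ext (semialg_not semialg_true) => e; split.
- move=> t u _ /andP[/term_polyfun[g pg Eg] /term_polyfun[h ph Eh]].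
  by exists (fun e => g e = h e) => [|e]; [exact: semialg_eq|rewrite Eg Eh].
- move=> t u _ /andP[/term_polyfun[g pg Eg] /term_polyfun[h ph Eh]].
  by exists (fun e => g e < h e) => [|e]; [exact: semialg_lt|rewrite Eg Eh].
- move=> t u _ /andP[/term_polyfun[g pg Eg] /term_polyfun[h ph Eh]].
  by exists (fun e => g e <= h e) => [|e]; [exact: semialg_le|rewrite Eg Eh].
- move=> f IHf g IHg /andP[qf qg] /andP[/(IHf qf)[P sP EP] /(IHg qg)[Q sQ EQ]].
  by exists (fun e => P e /\ Q e) => [|e]; [exact: semialg_and|rewrite EP EQ].
- move=> f IHf g IHg /andP[qf qg] /andP[/(IHf qf)[P sP EP] /(IHg qg)[Q sQ EQ]].
  by exists (fun e => P e \/ Q e) => [|e]; [exact: semialg_or|rewrite EP EQ].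
- move=> f IHf g IHg /andP[qf qg] /andP[/(IHf qf)[P sP EP] /(IHg qg)[Q sQ EQ]].
  exists (fun e => P e -> Q e) => [|e]; first exact: semialg_imply.
  by move: (EP e) (EQ e); tauto.
- move=> f IHf qf /(IHf qf)[P sP EP].
  by exists (fun e => ~ P e) => [|e]; [exact: semialg_not|rewrite EP].
Qed.

Lemma polyfun_supp g : polyfun g ->
  exists N, forall e e' : env, (forall i, (i < N)%N -> e i = e' i) ->
    g e = g e'.
Proof.
elim=> [c|i|g1 h1 _ [N HN] _ [M HM]|g1 h1 _ [N HN] _ [M HM]].
- by exists 0%N.
- by exists i.+1 => e e'; apply.
- exists (maxn N M) => e e' E.
  by rewrite (HN e e') ?(HM e e') // => i lti; apply: E;
    rewrite leq_max lti ?orbT.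
- exists (maxn N M) => e e' E.
  by rewrite (HN e e') ?(HM e e') // => i lti; apply: E;
    rewrite leq_max lti ?orbT.
Qed.

Lemma semialg_supp P : semialg P ->
  exists N, forall e e' : env, (forall i, (i < N)%N -> e i = e' i) ->
    P e <-> P e'.
Proof.
elim=> [g /polyfun_supp[N HN]|P1 Q1 _ [N HN] _ [M HM]|P1 _ [N HN]].
- by exists N => e e' /HN->.
- exists (maxn N M) => e e' E.
  by rewrite (HN e e') ?(HM e e') // => i lti; apply: E;
    rewrite leq_max lti ?orbT.
- by exists N => e e' E; rewrite (HN e e').
Qed.

Definition upd (e : env) i x : env := fun j => if j == i then x else e j.

(* This is where quantifier elimination is used. *)
Lemma semialg_exists P i : semialg P ->
  semialg (fun e => exists x, P (upd e i x)).
Proof.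
move=> sP; have [f rf Ef] := semialg_formula sP.
have rex : ord.rformula (ord.Exists i f) by [].
pose g := ord.quantifier_elim (@wproj R) (ord.Exists i f).
have /andP[qg rg] := ord.quantifier_elim_wf (@wf_QE_wproj R) rex.
have gP e : ord.holds e g <-> exists x, P (nth 0 (set_nth 0 e i x)).
  rewrite (rwP (ord.qf_evalP e qg)).
  have H := ord.quantifier_elim_rformP (@wf_QE_wproj R)
    (@valid_QE_wproj R) e rex.
  rewrite -(rwP H) /=.
  by split=> -[x Hx]; exists x; apply/Ef.
have [Q sQ EQ] := formula_semialg qg rg.
apply: semialg_ext (sQ) => e.
have [N HN] := semialg_supp sP; have [M HM] := semialg_supp sQ.
pose s := mkseq e (maxn N M).
have Es j : (j < maxn N M)%N -> nth 0 s j = e j by move=> lt_j;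
  rewrite nth_mkseq.
rewrite -(HM (nth 0 s)); last by move=> j lt_j; rewrite Es // leq_max lt_j orbT.
have Ex x : P (nth 0 (set_nth 0 s i x)) <-> P (upd e i x).
  apply: HN => j lt_j.
  by rewrite nth_set_nth /= /upd Es // leq_max lt_j.
by rewrite -EQ gP; split=> -[x Hx]; exists x; apply/Ex.
Qed.

End Semialgebraic.

Section Families.
Variables (R : realType) (m : nat).
Local Notation env := (nat -> R).

Definition put (e : env) a k (v : env) : env :=
  fun j => if (a <= j < a + k)%N then v (j - a)%N else e j.

Lemma semialg_exists_block (P : env -> Prop) a k : semialg P ->
  semialg (fun e => exists v, P (put e a k v)).
Proof.
elim: k P => [|k IH] P sP.
  apply: semialg_ext sP => e.
  have E v : put e a 0 v = e.
    by apply/funext => j; rewrite /put addn0; case: ifP => //; lia.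
  by split=> [Pe|[v]]; [exists e; rewrite E|rewrite E].
apply: semialg_ext (IH _ (semialg_exists (a + k) sP)) => e.
have E v : put e a k.+1 v = upd (put e a k v) (a + k) (v k).
  apply/funext => j; rewrite /put /upd addnS ltnS.
  have [->|ne] := eqVneq j (a + k)%N; first by rewrite leqnn leq_addr addKn.
  by congr (if _ then _ else _); lia.
split=> [[v [x Px]]|[v Pv]]; last by exists v, (v k); rewrite -E.
exists (fun j => if j == k then x else v j); rewrite E eqxx.
suff -> : put e a k (fun j => if j == k then x else v j) = put e a k v by [].
apply/funext => j; rewrite /put; case: ifP => // lt_j.
by case: eqP => // Ej; lia.
Qed.

Definition row_at (e : env) a : 'rV[R]_m := \row_i e (a + i)%N.

Definition semialg_family (P : R -> 'rV[R]_m -> Prop) :=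
  semialg (fun e => P (e 0%N) (row_at e 1)).

Definition polyfun_row (g : 'rV[R]_m -> R) := polyfun (fun e => g (row_at e 1)).

Definition argmin (P : R -> 'rV[R]_m -> Prop) (g : 'rV[R]_m -> R) s x :=
  P s x /\ forall y, P s y -> g x <= g y.

Lemma semialg_argmin P g : semialg_family P -> polyfun_row g ->
  semialg_family (argmin P g).
Proof.
move=> sP pg.
pose h (e : env) : env := fun j => if j == 0%N then e 0%N else e (j + m)%N.
have ph i : polyfun (fun e => h e i).
  by rewrite /h; case: (i == 0%N); exact: polyfun_var.
have Eh e : row_at (h e) 1 = row_at e m.+1.
  by apply/rowP => i; rewrite !mxE /h /=; congr e; lia.
have sQ := @semialg_exists_block _ m.+1 m
  (semialg_and (semialg_comp sP ph) (semialg_lt (polyfun_comp pg ph) pg)).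
apply: semialg_ext (semialg_and sP (semialg_not sQ)) => e.
have E1 v : row_at (put e m.+1 m v) 1 = row_at e 1.
  by apply/rowP => i; rewrite !mxE /put; case: ifP => //; have := ltn_ord i;
    lia.
split=> -[Pe H]; split=> //.
  move=> y Py; rewrite leNgt; apply/negP => lt_y; apply: H.
  exists (fun j => if insub j is Some i then y 0 i else 0).
  rewrite Eh E1.
  suff -> : row_at (put e m.+1 m (fun j =>
    if insub j is Some i then y 0 i else 0)) m.+1 = y.
    by rewrite /h /put.
  apply/rowP => i; rewrite !mxE /put leq_addr ltn_add2l ltn_ord /= addKn.
  by rewrite valK.
move=> [v]; rewrite Eh E1 => -[Pv]; rewrite ltNge => /negP; apply.
exact: H.
Qed.

(* Minimizes the functions of the list [gs] successively. *)
Definition lexmin P gs := foldl argmin P gs.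

Lemma semialg_lexmin P gs : semialg_family P ->
  (forall i, (i < size gs)%N -> polyfun_row (nth (fun=> 0) gs i)) ->
    semialg_family (lexmin P gs).
Proof.
elim: gs P => //= g gs IH P sP pgs; apply: IH; last by move=> i;
  exact: (pgs i.+1).
by apply: semialg_argmin => //; exact: (pgs 0%N isT).
Qed.

Lemma lexmin_sub P gs s x : lexmin P gs s x -> P s x.
Proof. by elim: gs P => //= g gs IH P /IH[]. Qed.

Lemma lexmin_const P gs s x y i : lexmin P gs s x -> lexmin P gs s y ->
  (i < size gs)%N -> nth (fun=> 0) gs i x = nth (fun=> 0) gs i y.
Proof.
elim: gs P i => //= g gs IH P [|i] Hx Hy; last exact: (IH (argmin P g) i Hx Hy).
move=> _ /=; have [Px gx] := lexmin_sub Hx; have [Py gy] := lexmin_sub Hy.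
by apply/eqP; rewrite eq_le gx // gy.
Qed.

Lemma argmin_compact P g s : compact (P s) -> P s !=set0 -> continuous g ->
  compact (argmin P g s) /\ argmin P g s !=set0.
Proof.
move=> cP nP cg.
have [c Pc cmin] := compact_EVT_min nP cP (continuous_subspaceT cg).
rewrite inE in Pc.
have E : argmin P g s = P s `&` [set x | g x <= g c].
  apply/seteqP; split=> x /= [Px gx]; split=> //; first exact: gx.
  by move=> y Py; apply: le_trans gx _; apply: cmin; rewrite inE.
split; last by exists c; split=> // y Py; apply: cmin; rewrite inE.
rewrite E; apply: compact_closedI => //.
by apply: (@preimage_closed _ _ g [set y | y <= g c]) => [x _|];
  [exact: cg|exact: closed_le].
Qed.

Lemma lexmin_nonempty P gs s : compact (P s) -> P s !=set0 ->
  (forall i, (i < size gs)%N -> continuous (nth (fun=> 0) gs i)) ->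
  lexmin P gs s !=set0.
Proof.
elim: gs P => //= g gs IH P cP nP cgs.
have [] := argmin_compact cP nP (cgs 0%N isT).
by move=> c' n'; apply: IH => // i; exact: (cgs i.+1).
Qed.

Definition sumsq (x : 'rV[R]_m) : R := \sum_i x 0 i ^+ 2.

Lemma polyfun_row_sumsq : polyfun_row sumsq.
Proof.
apply: polyfun_sum => i.
have -> : (fun e : env => row_at e 1 0 i ^+ 2) = (fun e => e (1 + i)%N ^+ 2).
  by apply/funext => e; rewrite mxE.
by apply: polyfunX; exact: polyfun_var.
Qed.

Definition env_of (s : R) (x : 'rV[R]_m) : env :=
  fun j => if j is i.+1 then oapp (x 0) 0 (insub i) else s.

Lemma row_at_env_of s x : row_at (env_of s x) 1 = x.
Proof. by apply/rowP => i; rewrite mxE /= valK. Qed.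

Lemma continuous_polyfun (g : env -> R) s : polyfun g ->
  continuous (fun x => g (env_of s x)).
Proof.
elim=> [c|i|g1 h1 _ IHg _ IHh|g1 h1 _ IHg _ IHh] x.
- exact: cst_continuous.
- case: i => [|i]; first exact: cst_continuous.
  rewrite /=; case: insubP => [k _ _|_] /=; first exact: coord_continuous.
  exact: cst_continuous.
- exact: (cvgD (IHg x) (IHh x)).
- exact: (cvgM (IHg x) (IHh x)).
Qed.

Lemma continuous_polyfun_row g : polyfun_row g -> continuous g.
Proof.
move=> /continuous_polyfun cg; have := cg 0.
suff -> : (fun x => g (row_at (env_of 0 x) 1)) = g by [].
by apply/funext => x; rewrite row_at_env_of.
Qed.

Lemma continuous_sumsq : continuous sumsq.
Proof. exact: (continuous_polyfun_row polyfun_row_sumsq). Qed.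

Lemma argmin_sumsq_compact P s : closed (P s) -> P s !=set0 ->
  compact (argmin P sumsq s) /\ argmin P sumsq s !=set0.
Proof.
move=> cP [x0 Px0].
pose P' s x := P s x /\ sumsq x <= sumsq x0.
have cP' : compact (P' s).
  apply: bounded_closed_compact; last first.
    apply: closedI => //.
    by apply: (@preimage_closed _ _ sumsq [set y | y <= sumsq x0]) => [x _|];
      [exact: continuous_sumsq|exact: closed_le].
  exists (Num.sqrt (sumsq x0)); split; first exact: num_real.
  move=> M ltM x [_ le_x].
  have M_ge0 : 0 <= M by apply: le_trans (ltW ltM); exact: sqrtr_ge0.
  apply: (@le_trans _ _ (mx_norm x)) => //; rewrite mx_normE;
    have -> : M = (NngNum M_ge0)%:num by [].
  rewrite num_le; apply/bigmax_leP; split=> [|[i j] _];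
    first by rewrite -num_le.
  rewrite -num_le /= ord1.
  rewrite -sqrtr_sqr; apply: le_trans (ltW ltM); apply: ler_wsqrtr.
  apply: le_trans le_x; rewrite /sumsq (bigD1 j) //= lerDl.
  by apply: sumr_ge0 => k _; exact: sqr_ge0.
have [] := argmin_compact cP' _ continuous_sumsq; first by exists x0; split.
suff -> : argmin P' sumsq s = argmin P sumsq s by [].
apply/seteqP; split=> x [].
  move=> [Px le_x] Hx; split=> // y Py.
  have [le_y|lt_y] := leP (sumsq y) (sumsq x0); first by apply: Hx.
  exact: le_trans le_x (ltW lt_y).
move=> Px Hx; split; first by split=> //; exact: Hx.
by move=> y [Py _]; exact: Hx.
Qed.

End Families.

Section Selection.
Variables (R : realType).
Local Notation env := (nat -> R).

Definition env2 (s y : R) : env :=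
  fun j => if j is j'.+1 then (if j' is 0 then y else 0) else s.

Lemma polyfun_bivariate (g : env -> R) : polyfun g ->
  exists q : {poly {poly R}}, forall s y, g (env2 s y) = q.[y%:P].[s].
Proof.
elim=> [c|i|g1 h1 _ [q Eq] _ [r Er]|g1 h1 _ [q Eq] _ [r Er]].
- by exists c%:P%:P => s y; rewrite !hornerC.
- case: i => [|[|i]]; last by exists 0 => s y; rewrite !horner0.
    by exists 'X%:P => s y; rewrite hornerC hornerX.
  by exists 'X => s y; rewrite hornerX hornerC.
- by exists (q + r) => s y; rewrite !hornerD Eq Er.
- by exists (q * r) => s y; rewrite !hornerM Eq Er.
Qed.

Lemma semialg_signs (P : env -> Prop) : semialg P ->
  exists2 l : seq {poly {poly R}}, 0 \notin l & forall s y y',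
    (forall q, q \in l -> (q.[y%:P].[s] <= 0) = (q.[y'%:P].[s] <= 0)) ->
    P (env2 s y) <-> P (env2 s y').
Proof.
elim=> [g /polyfun_bivariate[q Eq]|P1 Q1 _ [l nz_l Hl] _ [k nz_k Hk]|P1 _ [l
  nz_l Hl]].
- have [q0|nz_q] := eqVneq q 0.
    by exists [::] => // s y y' _; rewrite !Eq q0 !horner0.
  exists [:: q]; first by rewrite inE eq_sym.
  by move=> s y y' H; rewrite !Eq H // mem_head.
- exists (l ++ k); first by rewrite mem_cat negb_or nz_l.
  move=> s y y' H; rewrite (Hl s y y') ?(Hk s y y') // => q lq; apply: H;
    by rewrite mem_cat lq ?orbT.
- by exists l => // s y y' H; rewrite (Hl s y y').
Qed.

Lemma continuous_bivariate (q : {poly {poly R}}) (s : R) :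
  continuous (fun y : R => q.[y%:P].[s]).
Proof.
move=> y; elim/poly_ind: q => [|q c IH].
  rewrite (_ : (fun y => _) = fun=> 0); first exact: cst_continuous.
  by apply/funext => z; rewrite !horner0.
rewrite (_ : (fun y => _) = fun z : R => q.[z%:P].[s] * z + c.[s]); last first.
  by apply/funext => z; rewrite hornerMXaddC hornerD hornerM hornerC.
by apply: cvgD; [exact: (cvgM IH cvg_id)|exact: cvg_cst].
Qed.

(* [Q] is the product of the nonzero polynomials whose signs define [P]: where it
   does not vanish, [P (env2 s y)] would persist for all nearby [y]. *)
Lemma unique_algebraic (P : env -> Prop) : semialg P ->
  exists2 Q : {poly {poly R}}, Q != 0 & forall s,
   (forall y y', P (env2 s y) -> P (env2 s y') -> y = y') ->
   forall y, P (env2 s y) -> Q.[y%:P].[s] = 0.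
Proof.
move=> /semialg_signs[l nz_l Hl].
exists (\prod_(q <- l) q).
  rewrite prodf_seq_neq0; apply/allP => q lq /=.
  by apply: contraNneq nz_l => <-.
move=> s uniqP y Py; apply/eqP; apply: contraT => nz_Q.
have nz_q q : q \in l -> q.[y%:P].[s] != 0.
  move=> lq; apply: contraNneq nz_Q => q0.
  by rewrite (big_rem q lq) /= !hornerM q0 mul0r.
have Fy : Filter (nbhs y) := nbhs_filter y.
have near_sign : \forall y' \near y, forall q, q \in l ->
    (q.[y%:P].[s] <= 0) = (q.[y'%:P].[s] <= 0).
  elim: l nz_q {Hl nz_l nz_Q} => [|q l IH] nz_q;
    first by apply: filterE => y' q; rewrite in_nil.
  have {}IH := IH (fun p lp => nz_q p (mem_behead (s := q :: l) (x := p) lp)).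
  have Hq : \forall y' \near y, (q.[y%:P].[s] <= 0) = (q.[y'%:P].[s] <= 0).
    have cq := @continuous_bivariate q s y.
    have [lt0|gt0|/eqP] := ltrgtP q.[y%:P].[s] 0; last first.
    - by rewrite (negPf (nz_q q (mem_head _ _))).
    - have H : \forall t \near y, 0 < q.[t%:P].[s] := cvgr_gt _ cq _ gt0.
      apply: filterS (H Fy) => y' gt0'.
      by rewrite [RHS]leNgt gt0'.
    - have H : \forall t \near y, q.[t%:P].[s] < 0 := cvgr_lt _ cq _ lt0.
      apply: filterS (H Fy) => y' lt0'.
      by rewrite [RHS]ltW.
  apply: filterS2 Hq IH => y' Hq IH p; rewrite inE => /orP[/eqP->//|];
    exact: IH.
have /nbhs_ballP[e /= e_gt0 He] := near_sign.
have He' : ball y e (y + e / 2).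
  rewrite /ball /= opprD addrA subrr sub0r normrN gtr0_norm ?divr_gt0 //.
  by rewrite ltr_pdivrMr // mulr_natr mulr2n ltrDl.
have Py' : P (env2 s (y + e / 2)) by apply/(Hl s y _ (He _ He')).
by have := uniqP _ _ Py Py'; lra.
Qed.

Lemma algebraic_selection m (P : R -> 'rV[R]_m -> Prop) (s0 : R) :
  semialg_family P ->
  (forall s, s0 <= s -> closed (P s) /\ P s !=set0) ->
  exists (x : R -> 'rV[R]_m) (Q : 'I_m -> {poly {poly R}}),
    (forall i, Q i != 0) /\
    forall s, s0 <= s -> P s (x s) /\ forall i, (Q i).[(x s 0 i)%:P].[s] = 0.
Proof.
move=> sP cP.
pose coords : seq ('rV[R]_m -> R) :=
  [seq (fun x : 'rV[R]_m => x 0 i) | i <- enum 'I_m].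
pose L := lexmin (argmin P (@sumsq _ m)) coords.
have nth_coords (i : 'I_m) : nth (fun=> 0) coords i = fun x => x 0 i.
  by rewrite (nth_map i) ?size_enum_ord // nth_ord_enum.
have pcoords i : (i < size coords)%N -> polyfun_row (nth (fun=> 0) coords i).
  rewrite size_map size_enum_ord => lt_i.
  rewrite (nth_coords (Ordinal lt_i)) /polyfun_row.
  have -> : (fun e : env => row_at m e 1 0 (Ordinal lt_i)) = (fun e => e i.+1).
    by apply/funext => e; rewrite mxE.
  exact: polyfun_var.
have sL : semialg_family L.
  apply: semialg_lexmin => //; apply: semialg_argmin => //.
  exact: polyfun_row_sumsq.
have L_ex s : s0 <= s -> L s !=set0.
  move=> /cP[clP nP]; have [cA nA] := argmin_sumsq_compact clP nP.
  apply: lexmin_nonempty => // i /pcoords; exact: continuous_polyfun_row.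
have L_uniq s x y : L s x -> L s y -> x = y.
  move=> Lx Ly; apply/rowP => i.
  have := lexmin_const (i := i) Lx Ly.
  by rewrite size_map size_enum_ord nth_coords ltn_ord; apply.
have LP s x : L s x -> P s x by move=> /lexmin_sub[].
have /choice[Q HQ] : forall i, exists Q : {poly {poly R}}, Q != 0 /\
    forall s x, L s x -> Q.[(x 0 i)%:P].[s] = 0.
  move=> i.
  pose h (e : env) : env := fun j => if j == 0%N then e 0%N else e j.+1.
  have ph j : polyfun (fun e => h e j).
    by rewrite /h; case: (j == 0%N); exact: polyfun_var.
  have sE := @semialg_exists_block R _ 2 m (semialg_and (semialg_comp sL ph)
    (semialg_eq (polyfun_var _ (2 + i)%N) (polyfun_var _ 1%N))).
  have [q nz_q Hq] := unique_algebraic sE; exists q; split=> // s x Lx.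
  have EE y : (exists v, L (h (put (env2 s y) 2 m v) 0%N) (row_at m (h (put
    (env2 s y) 2 m v)) 1)
      /\ put (env2 s y) 2 m v (2 + i)%N =
        put (env2 s y) 2 m v 1) <-> exists2 x, L s x & x 0 i = y.
    have Ep (x' : 'rV[R]_m) : row_at m (h (put (env2 s y) 2 m (fun j =>
      oapp (x' 0) 0 (insub j)))) 1 = x'.
      apply/rowP => k; rewrite !mxE /h /put /= ?add1n.
      have := ltn_ord k; case: ifP; last by lia.
      by move=> _ _; rewrite (_ : (k.+2 - 2)%N = k) ?valK //; lia.
    split=> [[v [Lv Ev]]|[x' Lx' x'y]].
      exists (row_at m (h (put (env2 s y) 2 m v)) 1) => //.
      by rewrite mxE -[LHS]/(put (env2 s y) 2 m v (2 + i)%N) Ev.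
    exists (fun j => oapp (x' 0) 0 (insub j)); rewrite Ep; split=> //.
    by rewrite /put leq_addr ltn_add2l ltn_ord addKn valK.
  apply: (Hq s); last by apply/EE; exists x.
  by move=> y y' /EE[z Lz <-] /EE[z' Lz' <-]; rewrite (L_uniq _ _ _ Lz Lz').
have /choice[x Hx] : forall s, exists x, s0 <= s -> L s x.
  move=> s; have [/L_ex[x Lx]|_] := leP s0 s; first by exists x.
  by exists 0.
exists x, Q; split=> [i|s /Hx Ls]; first by have [] := HQ i.
by split=> [|i]; [exact: LP|have [_] := HQ i; apply].
Qed.

End Selection.

(** * Functions meromorphic at infinity *)

Section Modulus.
Variable R : realType.
Local Notation C := (R[i])%C.
Implicit Types z w : C.

Lemma cmod0 : cmod (0 : C) = 0. Proof. exact: ComplexField.Normc.normc0. Qed.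
Lemma cmod1 : cmod (1 : C) = 1. Proof. exact: ComplexField.Normc.normc1. Qed.
Lemma cmodM z w : cmod (z * w) = cmod z * cmod w.
Proof. exact: ComplexField.Normc.normcM. Qed.
Lemma cmodV z : cmod z^-1 = (cmod z)^-1.
Proof. exact: ComplexField.Normc.normcV. Qed.
Lemma cmodN z : cmod (- z) = cmod z.
Proof. exact: normcN. Qed.
Lemma cmodD z w : cmod (z + w) <= cmod z + cmod w.
Proof. exact: le_normcD. Qed.
Lemma cmodB z w : cmod (z - w) <= cmod z + cmod w.
Proof. by rewrite -(cmodN w); exact: cmodD. Qed.
Lemma cmod_ge0 z : 0 <= cmod z.
Proof. by case: z => a b; exact: sqrtr_ge0. Qed.
Lemma cmod_eq0 z : (cmod z == 0) = (z == 0).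
Proof.
apply/eqP/eqP => [|->]; last exact: cmod0.
exact: ComplexField.Normc.eq0_normc.
Qed.
Lemma cmod_gt0 z : (0 < cmod z) = (z != 0).
Proof. by rewrite lt_def cmod_ge0 andbT cmod_eq0. Qed.
Lemma cmodX z n : cmod (z ^+ n) = cmod z ^+ n.
Proof. by elim: n => [|n IH]; rewrite ?expr0 ?cmod1 // !exprS cmodM IH. Qed.
Lemma cmodXz z (n : int) : cmod (z ^ n) = cmod z ^ n.
Proof. by case: n => n; rewrite ?NegzE -?exprnN ?cmodV cmodX. Qed.
Lemma cmod_real (x : R) : cmod (x%:C)%C = `|x|.
Proof. by rewrite /cmod /= expr0n /= addr0 sqrtr_sqr. Qed.
Lemma cmod_sum (I : Type) (r : seq I) (P : pred I) (F : I -> C) :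
  cmod (\sum_(i <- r | P i) F i) <= \sum_(i <- r | P i) cmod (F i).
Proof.
elim/big_ind2: _ => [|x a y b xa yb|//]; first by rewrite cmod0.
by apply: le_trans (cmodD _ _) _; exact: lerD.
Qed.
Lemma cmod_distC z w : cmod (z - w) = cmod (w - z).
Proof. by rewrite -cmodN opprB. Qed.

Lemma cvg_cmodP (u : nat -> C) (l : C) :
  (u N @[N --> \oo] --> (l : R[i]^o)%C) <->
  forall e : R, 0 < e -> \forall N \near \oo, cmod (u N - l) < e.
Proof.
rewrite (_ : (u N @[N --> \oo] --> (l : R[i]^o)%C) =
  ((u : nat -> (R[i]^o)%C) @ \oo --> (l : R[i]^o)%C)) //.
split=> [/cvgrPdist_lt H e e_gt0|H].
  have := H (e%:C)%C; rewrite ltcR => /(_ e_gt0); apply: filterS => N.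
  by rewrite cmod_distC -ltcR.
apply/cvgrPdist_lt => e; rewrite ltcE /= => /andP[/eqP Ime Ree].
have Ee : e = ((complex.Re e)%:C)%C by case: e Ime {Ree} => a b /= ->.
have := H _ Ree; apply: filterS => N.
by rewrite cmod_distC Ee -ltcR.
Qed.

End Modulus.

Section Expansions.
Variable R : realType.
Local Notation C := (R[i])%C.
Implicit Types (g : C -> C) (a b : nat -> C) (k : int).

Definition psum a N (t : C) : C := \sum_(j < N) a j * t ^- j.

(* Error bounds for the truncations of an expansion of [g] with leading exponent
   at most [k]; unlike convergence itself, they multiply easily. *)
Definition expands g k a := exists B rho : R, [/\ 0 < B, 0 < rho &
  forall t, rho < cmod t -> forall N,
  cmod (g t * t ^ (- k) - psum a N t) <= B * (rho / cmod t) ^+ N].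

Lemma psumS a N t : psum a N.+1 t = psum a N t + a N * t ^- N.
Proof. exact: big_ord_recr. Qed.

Lemma psum0 a t : psum a 0 t = 0.
Proof. exact: big_ord0. Qed.

Lemma large_neq0 (rho : R) (t : C) : 0 < rho -> rho < cmod t -> t != 0.
Proof. by move=> r0 rt; rewrite -cmod_gt0 (lt_trans r0). Qed.

Lemma large_ratio (rho : R) (t : C) : 0 < rho -> rho < cmod t ->
  0 < rho / cmod t < 1.
Proof.
move=> r0 rt; have t0 := lt_trans r0 rt.
by rewrite divr_gt0 //= ltr_pdivrMr // mul1r.
Qed.

Lemma expands_coef g k a : expands g k a ->
  exists B rho : R, [/\ 0 < B, 0 < rho & forall j, cmod (a j) <= B * rho ^+ j].
Proof.
move=> [B [rho [B0 r0 H]]]; exists (B + B), (2 * rho); split; [lra|lra|].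
move=> j; pose t : C := ((2 * rho)%:C)%C.
have ct : cmod t = 2 * rho by rewrite cmod_real gtr0_norm; lra.
have rt : rho < cmod t by rewrite ct; lra.
have nz_t := large_neq0 r0 rt.
have E : a j * t ^- j = (g t * t ^ (- k) - psum a j t) - (g t * t ^
  (- k) - psum a j.+1 t).
  by rewrite psumS; ring.
have : cmod (a j * t ^- j) <= B + B.
  rewrite E; apply: le_trans (cmodB _ _) _.
  have /andP[q0 q1] := large_ratio r0 rt.
  by apply: lerD; apply: le_trans (H t rt _) _;
    rewrite ler_piMr ?(ltW B0) // exprn_ile1 // ltW.
rewrite cmodM cmodV cmodX ct ler_pdivrMr // exprn_gt0 //; lra.
Qed.

Lemma expands_rho g k a (B rho rho' : R) : 0 < B -> 0 < rho -> rho <= rho' ->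
  (forall t, rho < cmod t -> forall N,
    cmod (g t * t ^ (- k) - psum a N t) <= B * (rho / cmod t) ^+ N) ->
  forall t, rho' < cmod t -> forall N,
    cmod (g t * t ^ (- k) - psum a N t) <= B * (rho' / cmod t) ^+ N.
Proof.
move=> B0 r0 rr' H t rt N; have rt' : rho < cmod t by lra.
apply: le_trans (H t rt' N) _; rewrite ler_wpM2l ?(ltW B0) //.
have t0 : 0 < cmod t by lra.
apply: lerXn2r; rewrite ?nnegrE ?divr_ge0 ?(ltW t0) //; try lra.
by rewrite ler_wpM2r // invr_ge0 ltW.
Qed.

Lemma expands_cst c : expands (fun=> c) 0 (fun j => if j is 0 then c else 0).
Proof.
exists (cmod c + 1), 1; split=> // [|t rt N]; first by have := cmod_ge0 c; lra.
rewrite oppr0 expr0z mulr1; case: N => [|N].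
  by rewrite psum0 subr0 expr0; lra.
rewrite /psum big_ord_recl big1 ?addr0 ?expr0 ?divr1 ?subrr ?cmod0 => [|i _].
  apply: mulr_ge0; first by have := cmod_ge0 c; lra.
  by rewrite exprn_ge0 // divr_ge0 // cmod_ge0.
by rewrite /= mul0r.
Qed.

Lemma expands_shift g k a (p : int) : expands g k a ->
  expands (fun t => g t * t ^ p) (k + p) a.
Proof.
move=> [B [rho [B0 r0 H]]]; exists B, rho; split=> // t rt N.
have nz_t := large_neq0 r0 rt.
rewrite opprD expfzDr // mulrACA -[t ^ p * _]expfzDr // subrr expr0z mulr1.
exact: H.
Qed.

Lemma expands_pad g k a (p : nat) : expands g k a ->
  expands g (k + p%:Z) (fun j => if (j < p)%N then 0 else a (j - p)%N).
Proof.
move=> [B [rho [B0 r0 H]]]; exists (B * rho ^- p), rho.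
have rp : 0 < rho ^+ p by exact: exprn_gt0.
split=> //; first by rewrite divr_gt0.
move=> t rt N; have nz_t := large_neq0 r0 rt.
have /andP[q0 q1] := large_ratio r0 rt.
have t0 : 0 < cmod t by rewrite cmod_gt0.
have tp : 0 < cmod t ^+ p by exact: exprn_gt0.
have -> : g t * t ^ (- (k + p%:Z)) = t ^- p * (g t * t ^ (- k)).
  by rewrite opprD expfzDr // exprnN; ring.
have [le_Np|lt_pN] := leqP N p.
  rewrite [psum _ _ _]big1 => [|i _];
    last by rewrite (leq_trans (ltn_ord i)) ?mul0r.
  rewrite subr0 cmodM; have := H t rt 0%N;
    rewrite psum0 subr0 expr0 mulr1 => Hg.
  rewrite cmodV cmodX mulrC.
  apply: (@le_trans _ _ (B * (cmod t ^- p)));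
    first by rewrite ler_wpM2r // invr_ge0 ltW.
  rewrite -mulrA ler_wpM2l ?(ltW B0) //.
  have -> : cmod t ^- p = rho ^- p * (rho / cmod t) ^+ p.
    by rewrite expr_div_n mulrA mulVf ?mul1r // gt_eqF.
  rewrite ler_wpM2l // ?invr_ge0 ?(ltW rp) //.
  by apply: ler_wiXn2l => //; exact: ltW.
have -> : psum (fun j => if (j < p)%N then 0 else a (j - p)%N) N t =
    t ^- p * psum a (N - p) t.
  rewrite /psum -(subnKC (ltnW lt_pN)) big_split_ord /= [X in X + _]big1 ?add0r.
    rewrite addKn mulr_sumr; apply: eq_bigr => i _.
    by rewrite ltnNge leq_addr /= addKn exprD invfM; ring.
  by move=> i _; rewrite ltn_ord mul0r.
rewrite -mulrBr cmodM cmodV cmodX.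
apply: (@le_trans _ _ (cmod t ^- p * (B * (rho / cmod t) ^+ (N - p)))).
  by rewrite ler_wpM2l ?H // invr_ge0 ltW.
rewrite -{2}(subnKC (ltnW lt_pN)) exprD (expr_div_n rho (cmod t) p).
rewrite le_eqVlt; apply/orP; left; apply/eqP; field.
by rewrite !gt_eqF //; exact: exprn_gt0.
Qed.

Lemma expands_unpad g k a (p : nat) : expands g k a ->
  (forall j, (j < p)%N -> a j = 0) ->
    expands g (k - p%:Z) (fun j => a (p + j)%N).
Proof.
move=> [B [rho [B0 r0 H]]] a0; exists (B * rho ^+ p), rho.
have rp : 0 < rho ^+ p by exact: exprn_gt0.
split=> //; first exact: mulr_gt0.
move=> t rt N; have nz_t := large_neq0 r0 rt.
have t0 : 0 < cmod t by rewrite cmod_gt0.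
have -> : g t * t ^ (- (k - p%:Z)) = t ^+ p * (g t * t ^ (- k)).
  by rewrite opprB expfzDr // -[t ^ p%:Z]/(t ^+ p); ring.
have -> : psum (fun j => a (p + j)%N) N t = t ^+ p * psum a (p + N) t.
  rewrite /psum big_split_ord /= [X in _ * (X + _)]big1 ?add0r.
    rewrite mulr_sumr; apply: eq_bigr => i _; rewrite exprD; field.
    by rewrite !expf_neq0.
  by move=> i _; rewrite a0 ?mul0r.
rewrite -mulrBr cmodM cmodX.
apply: (@le_trans _ _ (cmod t ^+ p * (B * (rho / cmod t) ^+ (p + N)))).
  by rewrite ler_wpM2l ?H // exprn_ge0 // ltW.
rewrite exprD (expr_div_n rho (cmod t) p).
rewrite le_eqVlt; apply/orP; left; apply/eqP; field.
by rewrite !gt_eqF //; exact: exprn_gt0.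
Qed.

Lemma expandsD g h k a b : expands g k a -> expands h k b ->
  expands (fun t => g t + h t) k (fun j => a j + b j).
Proof.
move=> [B [rho [B0 r0 H]]] [B' [rho' [B0' r0' H']]].
pose r := Num.max rho rho'.
have rr : rho <= r by rewrite le_max lexx.
have rr' : rho' <= r by rewrite le_max lexx orbT.
have {}H := expands_rho B0 r0 rr H; have {}H' := expands_rho B0' r0' rr' H'.
exists (B + B'), r; split; [lra|lra|] => t rt N.
have -> : (g t + h t) * t ^ (- k) - psum (fun j => a j + b j) N t =
  (g t * t ^ (- k) - psum a N t) + (h t * t ^ (- k) - psum b N t).
  rewrite /psum; under eq_bigr do rewrite mulrDl.
  by rewrite big_split /=; ring.
apply: le_trans (cmodD _ _) _; rewrite mulrDl.
by apply: lerD; [exact: H|exact: H'].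
Qed.

Definition conv a b n : C := \sum_(i < n.+1) a i * b (n - i)%N.

Lemma psum_conv a b N t :
  psum (conv a b) N t = \sum_(i < N) a i * t ^- i * psum b (N - i) t.
Proof.
elim: N => [|N IH]; first by rewrite psum0 big_ord0.
rewrite psumS IH big_ord_recr /= subSn // subnn psumS psum0 add0r expr0 divr1.
have E (i : 'I_N) : a i * t ^- i * psum b (N.+1 - i) t =
   a i * t ^- i * psum b (N - i) t + a i * b (N - i)%N * t ^- N.
  rewrite subSn ?(ltnW (ltn_ord i)) // psumS mulrDr; congr (_ + _).
  have -> : t ^- N = t ^- i * t ^- (N - i).
    by rewrite -invfM -exprD subnKC // ltnW.
  by ring.
under [X in _ = X + _]eq_bigr do rewrite E.
rewrite big_split /= -addrA; congr (_ + _).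
rewrite /conv big_ord_recr /= subnn mulrDl mulr_suml; congr (_ + _); ring.
Qed.

(* Truncating the first factor at [i < N] and the second one at [N - i] gives the
   truncated product exactly, with [N] error terms of size [q ^ N]; the factor
   [N <= 2 ^ N] is absorbed by doubling the radius. *)
Lemma expandsM g h k l a b : expands g k a -> expands h l b ->
  expands (fun t => g t * h t) (k + l) (conv a b).
Proof.
move=> Hg [B' [rho' [B0' r0' H']]].
have [A [sigma [A0 s0 Ha]]] := expands_coef Hg.
have [B [rho [B0 r0 H]]] := Hg.
pose r := rho + rho' + sigma.
have {}H := expands_rho B0 r0 (_ : rho <= r) H.
have {}H' := expands_rho B0' r0' (_ : rho' <= r) H'.
exists (B * B' + A * B'), (2 * r); split;
  first by rewrite -mulrDl mulr_gt0 ?addr_gt0.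
  by rewrite /r; lra.
move=> t rt N.
have rt' : r < cmod t by move: rt; rewrite /r; lra.
have r_gt0 : 0 < r by rewrite /r; lra.
have nz_t := large_neq0 r_gt0 rt'.
have t0 : 0 < cmod t by rewrite cmod_gt0.
have le1 : rho <= r by rewrite /r; lra.
have le2 : rho' <= r by rewrite /r; lra.
have {}H := H le1 t rt'; have {}H' := H' le2 t rt'.
have /andP[q0 q1] := large_ratio r_gt0 rt'.
set q := r / cmod t in H H' q0 q1.
pose G := g t * t ^ (- k); pose K := h t * t ^ (- l).
have -> : g t * h t * t ^ (- (k + l)) - psum (conv a b) N t =
   (G - psum a N t) * K + \sum_(i < N) a i * t ^- i * (K - psum b (N - i) t).
  rewrite psum_conv opprD expfzDr //.
  have -> : \sum_(i < N) a i / t ^+ i * (K - psum b (N - i) t) =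
     psum a N t * K - \sum_(i < N) a i / t ^+ i * psum b (N - i) t.
    by rewrite /psum mulr_suml -sumrB; apply: eq_bigr => i _; rewrite mulrBr.
  by rewrite /G /K; ring.
apply: le_trans (cmodD _ _) _.
have KB : cmod K <= B'.
  by have := H' 0%N; rewrite psum0 subr0 expr0 mulr1.
have -> : 2 * r / cmod t = 2 * q by rewrite /q mulrA.
have Hterm (i : 'I_N) : cmod (a i * t ^- i * (K - psum b (N - i) t)) <=
  A * B' * q ^+ N.
  rewrite cmodM cmodM cmodV cmodX.
  apply: (@le_trans _ _ (A * q ^+ i * (B' * q ^+ (N - i)))); last first.
    have -> : q ^+ N = q ^+ i * q ^+ (N - i) by rewrite -exprD subnKC // ltnW.
    by rewrite le_eqVlt; apply/orP; left; apply/eqP; ring.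
  apply: ler_pM; rewrite ?mulr_ge0 ?invr_ge0 ?cmod_ge0 ?exprn_ge0 ?(ltW t0) //.
  rewrite ler_pdivrMr ?exprn_gt0 // -mulrA -exprMn /q divfK ?gt_eqF //.
  apply: le_trans (Ha i) _; rewrite ler_wpM2l ?(ltW A0) //.
  by apply: lerXn2r; rewrite ?nnegrE /r; lra.
have qN : 0 <= q ^+ N by rewrite exprn_ge0 // ltW.
have two_N : N%:R <= (2 : R) ^+ N.
  by rewrite -natrX ler_nat ltnW // ltn_expl.
rewrite [leRHS]mulrDl; apply: lerD.
  rewrite cmodM; apply: (@le_trans _ _ (B * q ^+ N * B')).
    by apply: ler_pM; rewrite ?cmod_ge0.
  rewrite mulrAC (exprMn _ 2 q); apply: ler_wpM2l;
    first by rewrite ltW // mulr_gt0.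
  by rewrite ler_peMl // exprn_ege1 //; lra.
apply: le_trans (cmod_sum _ _ _) _.
apply: (@le_trans _ _ (\sum_(i < N) A * B' * q ^+ N)); first exact: ler_sum.
rewrite sumr_const card_ord -[_ *+ N]mulr_natr -mulrA ler_wpM2l ?(ltW
  (mulr_gt0 A0 B0')) //.
by rewrite (exprMn _ 2 q) mulrC ler_wpM2r.
Qed.

End Expansions.

Lemma geometric_small (R : realType) (q e : R) : 0 <= q < 1 -> 0 < e ->
  \forall N \near \oo, q ^+ N < e.
Proof.
move=> /andP[q0 q1] e0.
have H : q ^+ N @[N --> \oo] --> 0 by apply: cvg_expr; rewrite ger0_norm.
exact: (cvgr_lt _ H _ e0).
Qed.

Lemma int_le_diff (k l : int) : k <= l -> exists n : nat, l = k + n%:Z.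
Proof. by exists (absz (l - k)%R); lia. Qed.

Lemma int_lt_diff (m' m : int) : m' < m -> exists n : nat, m = m' + 1 + n%:Z.
Proof. by rewrite -lezD1 => /int_le_diff. Qed.

Lemma int_subn_le (k : int) (j : nat) : k - j%:Z <= k.
Proof. by lia. Qed.

Lemma dist_subn (k : int) (j : nat) : absz (k - (k - j%:Z))%R = j.
Proof. by lia. Qed.

Section Meromorphic.
Variable R : realType.
Local Notation C := (R[i])%C.
Implicit Types (g : C -> C) (a b : nat -> C) (k m : int).

Lemma laurent_sumE k (a : nat -> C) (c : int -> C) (t : C) N : t != 0 ->
  (forall j : nat, c (k - j%:Z) = a j) ->
  \sum_(0 <= j < N) c (k - j%:Z) * t ^ (k - j%:Z) = t ^ k * psum a N t.
Proof.
move=> nz_t ca; rewrite big_mkord /psum mulr_sumr; apply: eq_bigr => j _.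
by rewrite ca expfzDr // -exprnN; ring.
Qed.

Lemma expands_laurent g k a : expands g k a ->
  laurent_at_infty g (fun m => if m <= k then a `|k - m|%N else 0).
Proof.
move=> [B [rho [B0 r0 H]]]; exists k; split=> [m ltkm|].
  by rewrite leNgt ltkm.
exists rho; split=> // t rt; apply/cvg_cmodP => e e0.
have nz_t := large_neq0 r0 rt.
have /andP[q0 q1] := large_ratio r0 rt.
have t0 : 0 < cmod t by rewrite cmod_gt0.
have tk : 0 < cmod t ^ k by rewrite exprz_gt0.
have e'0 : 0 < e / (cmod t ^ k * B) by rewrite divr_gt0 // mulr_gt0.
have Hq : \forall N \near \oo, (rho / cmod t) ^+ N < e / (cmod t ^ k * B).
  by apply: geometric_small => //; rewrite (ltW q0).
apply: filterS Hq => N HN.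
rewrite [X in cmod (X - _)](_ : _ = t ^ k * psum a N t); last first.
  apply: (laurent_sumE (c := fun m => if m <= k then a `|k - m|%N else 0)) =>
    // j.
  by rewrite int_subn_le dist_subn.
have -> : g t = t ^ k * (g t * t ^ (- k)).
  by rewrite mulrCA -expfzDr // subrr expr0z mulr1.
rewrite -mulrBr cmodM cmodXz cmod_distC.
apply: (@le_lt_trans _ _ (cmod t ^ k * (B * (rho / cmod t) ^+ N))).
  by rewrite ler_wpM2l ?H // ltW.
by rewrite mulrA mulrC -ltr_pdivlMr // mulr_gt0.
Qed.

Lemma laurent_expands g c k r : 0 < r ->
  (forall t : C, r < cmod t ->
      \sum_(0 <= j < N) c (k - j%:Z) * t ^ (k - j%:Z) @[N --> \oo]
        --> (g t : (R[i])^o)%C) ->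
  expands g k (fun j => c (k - j%:Z)).
Proof.
move=> r0 H; pose a (j : nat) := c (k - j%:Z).
have {}H t : r < cmod t -> t ^ k * psum a N t @[N --> \oo] --> (g t :
  (R[i])^o)%C.
  move=> rt; rewrite (_ : (fun N => t ^ k * psum a N t) =
     fun N => \sum_(0 <= j < N) c (k - j%:Z) * t ^ (k - j%:Z)); first exact: H.
  apply/funext => N; rewrite (laurent_sumE (a := a)) //.
  exact: large_neq0 r0 rt.
pose rho := r + 1; have rho0 : 0 < rho by rewrite /rho; lra.
pose t0 : C := (rho%:C)%C.
have ct0 : cmod t0 = rho by rewrite cmod_real gtr0_norm.
have rt0 : r < cmod t0 by rewrite ct0 /rho; lra.
have nz_t0 := large_neq0 r0 rt0.
have [M M0 HM] : exists2 M, 0 < M & forall j, cmod (a j) <= M * rho ^+ j.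
  have [N0 _ HN0] := (cvg_cmodP _ _).1 (H t0 rt0) 1 ltr01.
  pose w j := cmod (a j) * rho ^- j.
  have w_ge0 j : 0 <= w j by rewrite mulr_ge0 ?cmod_ge0 // invr_ge0 exprn_ge0 //
    ltW.
  have tk0 : 0 < rho ^ k by rewrite exprz_gt0.
  pose M := \sum_(j < N0) w j + 2 / rho ^ k.
  have Msum : 0 <= \sum_(j < N0) w j by exact: sumr_ge0.
  have M2 : 0 < 2 / rho ^ k by rewrite divr_gt0.
  exists M; first by rewrite /M; lra.
  move=> j; rewrite -ler_pdivrMr ?exprn_gt0 // -/(w j).
  have [lt_j|ge_j] := ltnP j N0.
    apply: le_trans (_ : \sum_(j < N0) w j <= M); last by rewrite /M; lra.
    by rewrite (bigD1 (Ordinal lt_j)) //= lerDl sumr_ge0.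
  apply: le_trans (_ : 2 / rho ^ k <= M); last by rewrite /M; lra.
  rewrite ler_pdivlMr //.
  have H1 := HN0 j ge_j; have H2 := HN0 j.+1 (leqW ge_j).
  have E : t0 ^ k * (a j * t0 ^- j) =
    (t0 ^ k * psum a j.+1 t0 - g t0) - (t0 ^ k * psum a j t0 - g t0).
    by rewrite psumS; ring.
  have : cmod (t0 ^ k * (a j * t0 ^- j)) <= 2.
    rewrite E; apply: le_trans (cmodB _ _) _; move: H1 H2 => /=; lra.
  by rewrite !cmodM cmodXz cmodV cmodX ct0 mulrC.
exists (2 * M), (2 * rho); split; [lra|lra|] => t rt N.
have t_gt0 : 0 < cmod t by lra.
have nz_t : t != 0 by rewrite -cmod_gt0.
have rt' : r < cmod t by move: rt; rewrite /rho; lra.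
set q := rho / cmod t.
have q0 : 0 < q by rewrite divr_gt0.
have q2 : q <= 1 / 2 by rewrite ler_pdivrMr //; lra.
have Hd d : cmod (psum a (N + d) t - psum a N t) <=
  2 * M * q ^+ N * (1 - q ^+ d).
  elim: d => [|d IH]; first by rewrite addn0 subrr cmod0 expr0 subrr mulr0.
  rewrite addnS psumS addrAC; apply: le_trans (cmodD _ _) _.
  have Hj : cmod (a (N + d)%N * t ^- (N + d)) <= M * q ^+ N * q ^+ d.
    rewrite cmodM cmodV cmodX ler_pdivrMr ?exprn_gt0 //.
    by rewrite -mulrA -exprD -mulrA -exprMn /q divfK ?gt_eqF.
  apply: le_trans (lerD IH Hj) _; rewrite exprS.
  have MqN : 0 <= M * q ^+ N * q ^+ d by rewrite !mulr_ge0 ?exprn_ge0 ?ltW.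
  rewrite -subr_ge0.
  have -> : 2 * M * q ^+ N * (1 - q * q ^+ d) - (2 * M * q ^+ N *
    (1 - q ^+ d) + M * q ^+ N * q ^+ d)
     = M * q ^+ N * q ^+ d * (1 - 2 * q) by ring.
  by rewrite mulr_ge0 //; lra.
have tk : 0 < cmod t ^ k by rewrite exprz_gt0.
apply: (@le_trans _ _ (2 * M * q ^+ N)); last first.
  rewrite ler_wpM2l //; first by lra.
  have -> : 2 * rho / cmod t = 2 * q by rewrite /q mulrA.
  rewrite (exprMn _ 2 q) ler_peMl ?exprn_ege1 //; last by lra.
  by rewrite exprn_ge0 // ltW.
apply/ler_addgt0Pr => e e0.
have e'0 : 0 < e * cmod t ^ k by rewrite mulr_gt0.
have [N1 _ HN1] := (cvg_cmodP _ _).1 (H t rt') _ e'0.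
have := HN1 (N + N1)%N (leq_addl _ _) => /=.
have -> : t ^ k * psum a (N + N1) t - g t =
  t ^ k * (psum a (N + N1) t - g t * t ^ (- k)).
  by rewrite mulrBr [t ^ k * (g t * _)]mulrCA -expfzDr // subrr expr0z mulr1.
rewrite cmodM cmodXz mulrC ltr_pM2r // => /ltW H1.
have -> : g t * t ^ (- k) - psum a N t =
   (psum a (N + N1) t - psum a N t) - (psum a (N +
     N1) t - g t * t ^ (- k)) by ring.
apply: le_trans (cmodB _ _) _; apply: lerD => //.
apply: le_trans (Hd N1) _.
rewrite ler_piMr ?mulr_ge0 ?exprn_ge0 //; try lra.
by have := exprn_ge0 N1 (ltW q0); lra.
Qed.

Lemma meromorphicP g : meromorphic_at_infty g <-> exists k a, expands g k a.
Proof.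
split=> [[c [k [_ [r [r0 H]]]]]|[k [a H]]].
  by exists k; eexists; exact: laurent_expands H.
by eexists; exact: expands_laurent H.
Qed.

Definition has_order g m := exists al be r : R, [/\ 0 < al, 0 < be, 0 < r &
  forall t, r < cmod t -> al * cmod t ^ m <= cmod (g t) <= be * cmod t ^ m].

Lemma expands_lead g k a : expands g k a -> a 0%N != 0 -> has_order g k.
Proof.
move=> [B [rho [B0 r0 H]]]; rewrite -cmod_gt0; set A := cmod (a 0%N) => A0.
exists (A / 2), (2 * A), (rho + 2 * B * rho / A).
have X0 : 0 < 2 * B * rho / A by rewrite divr_gt0 // !mulr_gt0.
split; [lra|lra|lra|] => t rt.
have rt' : rho < cmod t by lra.
have nz_t := large_neq0 r0 rt'.
have t0 : 0 < cmod t by rewrite cmod_gt0.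
have tk : 0 < cmod t ^ k by rewrite exprz_gt0.
have Eg : cmod (g t) = cmod (g t * t ^ (- k)) * cmod t ^ k.
  by rewrite -cmodXz -cmodM -mulrA -expfzDr // addrC subrr expr0z mulr1.
have := H t rt' 1%N; rewrite psumS psum0 add0r expr0 divr1 expr1 => Hg.
have small : B * (rho / cmod t) <= A / 2.
  rewrite mulrA ler_pdivrMr //.
  have : 2 * B * rho / A < cmod t by lra.
  by rewrite ltr_pdivrMr //; lra.
have := cmodB (g t * t ^ (- k)) (g t * t ^ (- k) - a 0%N).
have := cmodD (a 0%N) (g t * t ^ (- k) - a 0%N).
rewrite subKr addrC subrK -/A => H1 H2.
by rewrite Eg !ler_pM2r //; apply/andP; split; lra.
Qed.

Definition ev_zero g := exists2 r : R, 0 < r & forall t, r < cmod t -> g t = 0.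

Lemma expands_eq0 g k a : expands g k a -> (forall j, a j = 0) -> ev_zero g.
Proof.
move=> [B [rho [B0 r0 H]]] a0; exists rho => // t rt.
have nz_t := large_neq0 r0 rt; have /andP[q0 q1] := large_ratio r0 rt.
suff /eqP : cmod (g t * t ^ (- k)) = 0.
  by rewrite cmod_eq0 mulf_eq0 (negPf (expfz_neq0 _ nz_t)) orbF => /eqP.
apply: le_anti; rewrite cmod_ge0 andbT; apply/ler_addgt0Pr => e e0.
have [N _ HN] : \forall N \near \oo, (rho / cmod t) ^+ N < e / B.
  by apply: geometric_small; [rewrite (ltW q0)|exact: divr_gt0].
have := H t rt N; rewrite /psum big1 ?subr0 => [|i _]; last by rewrite a0 mul0r.
move=> Hg; rewrite add0r; apply: le_trans Hg _.
by rewrite mulrC -ler_pdivlMr // ltW //; exact: (HN N (leqnn N)).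
Qed.

Lemma has_order_neq0 g m : has_order g m -> ~ ev_zero g.
Proof.
move=> [al [be [r [al0 be0 r0 H]]]] [r' r'0 H'].
pose t : C := ((r + r' + 1)%:C)%C.
have ct : cmod t = r + r' + 1 by rewrite cmod_real gtr0_norm; lra.
have := H t; rewrite ct H' ?cmod0 ?ct; last by lra.
have : r < r + r' + 1 by lra.
move=> /[swap] /[apply] /andP[+ _]; apply/negP;
  rewrite -ltNge mulr_gt0 // exprz_gt0 //; lra.
Qed.

Lemma has_order_le g m m' : has_order g m -> has_order g m' -> m <= m'.
Proof.
move=> [al [be [r [al0 be0 r0 H]]]] [al' [be' [r' [al'0 be'0 r'0 H']]]].
rewrite leNgt; apply/negP => lt_m.
have X0 : 0 < be' / al by rewrite divr_gt0.
pose x := r + r' + be' / al + 1.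
pose t : C := (x%:C)%C.
have ct : cmod t = x by rewrite cmod_real gtr0_norm // /x; lra.
have /andP[h1 _] := H t ltac:(rewrite ct /x; lra).
have /andP[_ h2] := H' t ltac:(rewrite ct /x; lra).
have x0 : 0 < x by rewrite /x; lra.
have x1 : 1 <= x by rewrite /x; lra.
have := le_trans h1 h2; apply/negP; rewrite -ltNge ct.
have [n En] := int_lt_diff lt_m.
rewrite En !expfzDr ?gt_eqF // expr1z.
have xm : 0 < x ^ m' by rewrite exprz_gt0.
have xn : 1 <= x ^ n%:Z by exact: exprn_ege1.
apply: (@lt_le_trans _ _ (al * (x ^ m' * x))).
  rewrite mulrCA mulrC ltr_pM2l // mulrC -ltr_pdivrMr //.
  by rewrite /x; lra.
by rewrite ler_pM2l // ler_peMr // mulr_ge0 // ltW.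
Qed.

Lemma laurent_order g c m : laurent_at_infty g c -> c m <> 0 ->
  exists2 m', m <= m' & has_order g m' /\ c m' <> 0.
Proof.
move=> [k [c0 [r [r0 H]]]] /eqP nz_c.
have Hexp := laurent_expands r0 H.
pose P p := c (k - p%:Z) != 0.
have exP : exists p, P p.
  exists `|k - m|%N; rewrite /P (_ : k - `|k - m|%N%:Z = m) //.
  have [|/c0 E] := leP m k; first by lia.
  by move: nz_c; rewrite E eqxx.
case: (ex_minnP exP) => p Pp minp; exists (k - p%:Z).
  have [|/c0 E] := leP m k; last by move: nz_c; rewrite E eqxx.
  move=> le_m; have : P `|k - m|%N
    by rewrite /P (_ : k - `|k - m|%N%:Z = m) //; lia.
  by move/minp; lia.
split; last by apply/eqP.
apply: expands_lead (expands_unpad (p := p) Hexp _) _; last by rewrite addn0.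
by move=> j lt_j; apply/eqP; apply: contraT => /minp; lia.
Qed.

Lemma deg_infty_ev_zero g : ev_zero g -> deg_infty g = -oo%E.
Proof.
move=> g0; rewrite /deg_infty; set A := (X in ereal_sup X).
suff -> : A = set0 by rewrite ereal_sup0.
apply/seteqP; split=> // x [m [c Hc nz_c] _].
by have [m' _ [/has_order_neq0]] := laurent_order Hc nz_c.
Qed.

Lemma deg_infty_order g m : meromorphic_at_infty g -> has_order g m ->
  deg_infty g = (m%:~R)%:E.
Proof.
move=> [c Hc] om; apply/eqP; rewrite eq_le; apply/andP; split.
  apply: ub_ereal_sup => _ [m' [c' Hc' nz_c'] <-].
  have [p le_p [op _]] := laurent_order Hc' nz_c'.
  rewrite lee_fin ler_int; apply: le_trans le_p _; exact: has_order_le op om.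
apply: ereal_sup_ubound; exists m => //; exists c => //.
have [[m' nz]|nex] := pselect (exists m', c m' <> 0).
  have [p _ [op nz_p]] := laurent_order Hc nz.
  have E : m = p by apply/eqP;
    rewrite eq_le (has_order_le om op) (has_order_le op om).
  by rewrite E.
exfalso; apply: (has_order_neq0 om).
have [k [c0 [r [r0 H]]]] := Hc.
apply: (expands_eq0 (laurent_expands r0 H)) => j.
by apply/eqP; apply: contraT => /eqP nz; case: nex; exists (k - j%:Z).
Qed.

Lemma meromorphic_cases g : meromorphic_at_infty g ->
  (ev_zero g /\ deg_infty g = -oo%E) \/
  exists2 m : int, has_order g m & deg_infty g = (m%:~R)%:E.
Proof.
move=> Hg; have [c Hc] := Hg.
have [[m nz]|nex] := pselect (exists m, c m <> 0).
  by right; have [p _ [op _]] := laurent_order Hc nz; exists p => //;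
    exact: deg_infty_order.
left; have g0 : ev_zero g.
  have [k [c0 [r [r0 H]]]] := Hc.
  apply: (expands_eq0 (laurent_expands r0 H)) => j.
  by apply/eqP; apply: contraT => /eqP nz; case: nex; exists (k - j%:Z).
by split=> //; exact: deg_infty_ev_zero.
Qed.

Lemma meromorphic_cst (c : C) : meromorphic_at_infty (fun=> c).
Proof. by apply/meromorphicP; do 2 eexists; exact: expands_cst. Qed.

Lemma meromorphic_exprz (p : int) : meromorphic_at_infty (fun t : C => t ^ p).
Proof.
apply/meromorphicP; have := expands_shift p (expands_cst (1 : C)).
have -> : (fun t : C => 1 * t ^ p) = (fun t => t ^ p) by apply/funext => t;
  rewrite mul1r.
by move=> H; do 2 eexists; exact: H.
Qed.

Lemma meromorphicM g h : meromorphic_at_infty g -> meromorphic_at_infty h ->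
  meromorphic_at_infty (fun t => g t * h t).
Proof.
move=> /meromorphicP[k [a Ha]] /meromorphicP[l [b Hb]].
by apply/meromorphicP; do 2 eexists; exact: expandsM Ha Hb.
Qed.

Lemma meromorphicD g h : meromorphic_at_infty g -> meromorphic_at_infty h ->
  meromorphic_at_infty (fun t => g t + h t).
Proof.
move=> /meromorphicP[k [a Ha]] /meromorphicP[l [b Hb]]; apply/meromorphicP.
wlog le_kl : g h k l a b Ha Hb / k <= l => [W|].
  have [le_kl|/ltW le_lk] := leP k l; first exact: W Ha Hb le_kl.
  have [k' [a' H']] := W _ _ _ _ _ _ Hb Ha le_lk; exists k', a'.
  by rewrite (_ : (fun t => _) = fun t => h t + g t) //; apply/funext => t;
    exact: addrC.
have [n En] := int_le_diff le_kl.
have := expands_pad n Ha; rewrite -En => Ha'.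
by do 2 eexists; exact: expandsD Ha' Hb.
Qed.

Lemma meromorphic_sum (I : Type) (r : seq I) (F : I -> C -> C) :
  (forall i, meromorphic_at_infty (F i)) ->
  meromorphic_at_infty (fun t => \sum_(i <- r) F i t).
Proof.
move=> HF; elim: r => [|i r IH].
  rewrite (_ : (fun t => _) = fun=> 0); first exact: meromorphic_cst.
  by apply/funext => t; rewrite big_nil.
rewrite (_ : (fun t => _) = fun t => F i t + \sum_(j <- r) F j t).
  exact: (meromorphicD (HF i) IH).
by apply/funext => t; rewrite big_cons.
Qed.

Lemma meromorphic_prod (I : Type) (r : seq I) (F : I -> C -> C) :
  (forall i, meromorphic_at_infty (F i)) ->
  meromorphic_at_infty (fun t => \prod_(i <- r) F i t).
Proof.
move=> HF; elim: r => [|i r IH].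
  rewrite (_ : (fun t => _) = fun=> 1); first exact: meromorphic_cst.
  by apply/funext => t; rewrite big_nil.
rewrite (_ : (fun t => _) = fun t => F i t * \prod_(j <- r) F j t).
  exact: (meromorphicM (HF i) IH).
by apply/funext => t; rewrite big_cons.
Qed.

Lemma meromorphicX g n : meromorphic_at_infty g ->
  meromorphic_at_infty (fun t => g t ^+ n).
Proof.
move=> Hg; elim: n => [|n IH]; first exact: meromorphic_cst.
rewrite (_ : (fun t => _) = fun t => g t * g t ^+ n);
  first exact: (meromorphicM Hg IH).
by apply/funext => t; rewrite exprS.
Qed.

Lemma meromorphic_peval n (f : mpoly.mpoly n C) (Phi : C -> 'rV[C]_n) :
  (forall i, meromorphic_at_infty (fun t => Phi t 0 i)) ->
  meromorphic_at_infty (fun t => peval f (Phi t)).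
Proof.
move=> HPhi; rewrite /peval.
rewrite (_ : (fun t => _) = fun t => \sum_(m <- mpoly.msupp f)
   mpoly.mcoeff m f * \prod_(i <- index_enum 'I_n) Phi t 0 i ^+
     mpoly.fun_of_multinom m i); last first.
  by apply/funext => t; rewrite mpoly.mevalE.
apply: meromorphic_sum => m; apply: (meromorphicM (meromorphic_cst _)).
by apply: meromorphic_prod => i; exact: (meromorphicX _ (HPhi i)).
Qed.

End Meromorphic.

(** * The two infima *)

Section MaxNorm.
Variables (R : realType) (n : nat).
Local Notation C := (R[i])%C.
Implicit Types z w : 'rV[C]_n.

Lemma maxnorm_ge0 z : 0 <= maxnorm z.
Proof. by rewrite /maxnorm; elim/big_rec: _ => // i x _; rewrite le_max => ->;
  rewrite orbT. Qed.

Lemma le_maxnorm z i : cmod (z 0 i) <= maxnorm z.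
Proof. by rewrite /maxnorm (bigD1 i) //= le_max lexx. Qed.

Lemma maxnorm_le z (x : R) : 0 <= x -> (forall i, cmod (z 0 i) <= x) ->
  maxnorm z <= x.
Proof.
move=> x0 H; rewrite /maxnorm; elim/big_ind: _ => // a b ax bx.
by rewrite ge_max ax.
Qed.
End MaxNorm.

Section TupleDegree.
Variable R : realType.
Local Notation C := (R[i])%C.

Definition rorder (A : C -> R) (m : int) := exists al be r : R,
  [/\ 0 < al, 0 < be, 0 < r &
  forall t, r < cmod t -> al * cmod t ^ m <= A t <= be * cmod t ^ m].

Definition rzero (A : C -> R) :=
  exists2 r : R, 0 < r & forall t, r < cmod t -> A t = 0.

Lemma rorder_eq (A B : C -> R) m (r : R) : 0 < r ->
  (forall t, r < cmod t -> A t = B t) -> rorder B m -> rorder A m.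
Proof.
move=> r0 AB [al [be [r' [al0 be0 r'0 H]]]]; exists al, be, (r + r');
  split=> //; first by lra.
by move=> t rt; rewrite AB ?H //; lra.
Qed.

Lemma rorder_max (A B : C -> R) m m' : rorder A m -> rorder B m' ->
  rorder (fun t => Num.max (A t) (B t)) (Num.max m m').
Proof.
wlog le_m : A B m m' / m <= m' => [W HA HB|].
  case/orP: (le_total m m') => le_m; first exact: W.
  rewrite [Num.max m m']maxC.
  rewrite (_ : (fun t => _) = fun t => Num.max (B t) (A t)).
    exact: (W _ _ _ _ le_m HB HA).
  by apply/funext => t; rewrite maxC.
move=> [al [be [r [al0 be0 r0 H]]]] [al' [be' [r' [al'0 be'0 r'0 H']]]].
have -> : Num.max m m' = m' by apply/max_idPr.
have [d Ed] := int_le_diff le_m; rewrite Ed in H' *.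
exists al', (be + be'), (r + r' + 1); split; [lra|lra|lra|] => t rt.
have /andP[_ h] := H t ltac:(lra); have /andP[h1 h2] := H' t ltac:(lra).
have t1 : 1 <= cmod t by lra.
have tm : 0 < cmod t ^ m by rewrite exprz_gt0; lra.
have Et : cmod t ^ (m + d%:Z) = cmod t ^ m * cmod t ^+ d.
  by rewrite expfzDr // gt_eqF; lra.
have tmd : cmod t ^ m <= cmod t ^ (m + d%:Z)
  by rewrite Et ler_peMr ?exprn_ege1 // ltW.
apply/andP; split; first by rewrite le_max h1 orbT.
rewrite ge_max; apply/andP; split.
  apply: le_trans h _; apply: ler_pM => //; lra.
by apply: le_trans h2 _; rewrite ler_wpM2r //; lra.
Qed.

Lemma tuple_deg_cases n (Phi : C -> 'rV[C]_n) :
  (forall i, meromorphic_at_infty (fun t => Phi t 0 i)) ->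
  (rzero (fun t => maxnorm (Phi t)) /\ tuple_deg_infty Phi = -oo%E) \/
  exists2 m : int, rorder (fun t => maxnorm (Phi t)) m &
    tuple_deg_infty Phi = (m%:~R)%:E.
Proof.
move=> HPhi; rewrite /maxnorm /tuple_deg_infty.
elim: (index_enum _) => [|i s IH].
  left; split; last by rewrite big_nil.
  by exists 1 => // t _; rewrite big_nil.
set S := fun t => \big[Num.max/0]_(j <- s) cmod (Phi t 0 j) in IH.
have E : (fun t => \big[Num.max/0]_(j <- i :: s) cmod (Phi t 0 j)) =
  fun t => Num.max (cmod (Phi t 0 i)) (S t).
  by apply/funext => t; rewrite big_cons.
rewrite E big_cons {E}.
have S0 t : 0 <= S t by rewrite /S; elim/big_rec: _ => // j x _;
  rewrite le_max => ->; rewrite orbT.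
have [[[r r0 H] ->]|[m Hm ->]] := meromorphic_cases (HPhi i).
  have rS t : r < cmod t -> Num.max (cmod (Phi t 0 i)) (S t) = S t.
    by move=> /H ->; rewrite cmod0; apply/max_idPr.
  case: IH => [[[r' r'0 H'] ->]|[m Hm ->]].
    left; split; last by rewrite maxxx.
    exists (r + r'); first by lra.
    by move=> t rt; rewrite rS ?H' //; lra.
  by right; exists m; [exact: rorder_eq rS Hm|rewrite maxNye].
case: IH => [[[r' r'0 H'] ->]|[m' Hm' ->]].
  right; exists m; last by rewrite maxeNy.
  apply: (rorder_eq (B := fun t => cmod (Phi t 0 i)) r'0) Hm => t /H' ->.
  by apply/max_idPl; exact: cmod_ge0.
right; exists (Num.max m m'); first exact: rorder_max.
by rewrite -EFin_max; congr EFin; have [le_m|le_m] := leP m m';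
  [rewrite max_r // ler_int|rewrite max_l // ler_int ltW].
Qed.

End TupleDegree.

Section FiberExponent.
Variables (R : realType) (n : nat) (f : mpoly.mpoly n (R[i])%C) (l0 : (R[i])%C).
Local Notation C := (R[i])%C.
Local Notation L := (fun delta : R =>
  loj_infty (grad f) (peval f @^-1` disc l0 delta)).

Lemma loj_fiber_nonincreasing (d d' : R) : d <= d' -> (L d' <= L d)%E.
Proof.
move=> le_d; apply: le_ereal_sup => _ [nu [A [B [A0 B0 H]]] <-];
  exists nu => //.
exists A, B; split=> // z Sz; apply: H.
by rewrite /= /disc /=; apply: lt_le_trans le_d.
Qed.

Lemma loj_fiber_cvg : cvg (L delta @[delta --> (0 : R)^'+]).
Proof.
apply: nonincreasing_at_right_is_cvge; apply: nearW => x.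
by move=> d d' _ _ /loj_fiber_nonincreasing.
Qed.

Lemma malgrange_fiber : malgrange f l0 -> ((-1)%:E <= loj_infty_fiber f l0)%E.
Proof.
move=> [eta [delta [R0 [eta0 delta0 R00 H]]]].
apply: lime_ge; first exact: loj_fiber_cvg.
have near_d : \forall d \near (0 : R)^'+, d < delta by exact: nbhs_right_lt.
apply: filterS near_d => d lt_d.
apply: ereal_sup_ubound; exists (-1) => //; exists eta, R0;
  split=> // z Sz lt_z.
have z0 : 0 < maxnorm z by lra.
rewrite powR_inv1 ?(ltW z0) // ler_pdivrMr // mulrC.
by apply/ltW/H => //; apply: lt_trans lt_d.
Qed.

Lemma meromorphic_small (g : C -> C) : meromorphic_at_infty g ->
  (deg_infty g < 0)%E ->
  forall e : R, 0 < e -> exists2 r, 0 < r & forall t, r < cmod t ->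
    cmod (g t) < e.
Proof.
move=> Hg deg0 e e0; have [[[r r0 H] _]|[m [al [be [r [al0 be0 r0 H]]]] Dg]] :=
  meromorphic_cases Hg.
  by exists r => // t /H ->; rewrite cmod0.
move: deg0; rewrite Dg lte_fin ltrz0 => m0.
have m1 : m <= -1 by rewrite -ltzD1 addNr.
have X0 : 0 < be / e by rewrite divr_gt0.
exists (r + be / e + 1); first by lra.
move=> t rt; have /andP[_ h] := H t ltac:(lra).
have t1 : 1 <= cmod t by lra.
apply: le_lt_trans h _; apply: (@le_lt_trans _ _ (be * cmod t ^ (-1))).
  by rewrite ler_wpM2l ?(ltW be0) // ler_weXz2l.
rewrite exprN1 ltr_pdivrMr; last by lra.
by rewrite mulrC -ltr_pdivrMr //; lra.
Qed.

Lemma powR_growth (p M : R) : 0 < p -> exists2 T, 1 < T & forall x, T < x ->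
  M < x `^ p.
Proof.
move=> p0; have M0 : 0 < `|M| + 1 by have := normr_ge0 M; lra.
have T0 : 0 <= (`|M| + 1) `^ p^-1 by exact: powR_ge0.
exists ((`|M| + 1) `^ p^-1 + 2); first by lra.
move=> x ltx; apply: (@lt_le_trans _ _ (`|M| + 1));
  first by have := ler_norm M; lra.
have -> : `|M| + 1 = ((`|M| + 1) `^ p^-1) `^ p.
  by rewrite -powRrM mulVf ?lt0r_neq0 // powRr1 // ltW.
apply: ge0_ler_powR; rewrite ?nnegrE //; [exact: ltW|lra|lra].
Qed.

Lemma curve_fiber : (loj_infty_curves f l0 < (-1)%:E)%E ->
  (loj_infty_fiber f l0 < (-1)%:E)%E.
Proof.
move=> /ereal_inf_lt[_ [Phi [HPhi deg_pos deg_neg] <-] ltr].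
have HG i : meromorphic_at_infty (fun t => grad f (Phi t) 0 i).
  rewrite (_ : (fun t => _) = fun t => peval (mpoly.mderiv i f) (Phi t)).
    exact: meromorphic_peval.
  by apply/funext => t; rewrite mxE.
have [[_ E]|[d Hd Ed]] := tuple_deg_cases HPhi; first by rewrite E in deg_pos.
rewrite Ed lte_fin ltr0z in deg_pos.
have dR : (0 : R) < d%:~R by rewrite ltr0z.
have [e [lt_e [be2 [r2 [be20 r20 Hr2]]]]] : exists e : int, e < - d /\
    exists be r : R, [/\ 0 < be, 0 < r & forall t, r < cmod t ->
      maxnorm (grad f (Phi t)) <= be * cmod t ^ e].
  have [[[r r0 H] _]|[e [al [be [r [al0 be0 r0 H]]]] Ee]] := tuple_deg_cases HG.
    exists (- d - 1); split; first by rewrite ltrBlDr ltrDl.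
    exists 1, r; split=> // t rt; rewrite H // mul1r.
    by apply: exprz_ge0; exact: cmod_ge0.
  exists e; split; last by exists be, r; split=> // t /H/andP[].
  move: ltr; rewrite Ee Ed inver gt_eqF // -EFinM lte_fin.
  by rewrite ltr_pdivrMr // mulN1r -rmorphN /= ltr_int.
pose beta : R := e%:~R / d%:~R.
have beta1 : beta < -1 by rewrite ltr_pdivrMr // mulN1r -rmorphN /= ltr_int.
apply: (@le_lt_trans _ _ beta%:E); last by rewrite lte_fin.
apply: lime_le; first exact: loj_fiber_cvg.
have near_d : \forall x \near (0 : R)^'+, 0 < x by exact: nbhs_right_gt.
apply: filterS near_d => delta delta0.
apply: ub_ereal_sup => _ [nu [A [B [A0 B0 H]]] <-]; rewrite lee_fin leNgt;
  apply/negP => lt_nu.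
have [al [be [r [al0 be0 r0 Hr]]]] := Hd.
have Hf : meromorphic_at_infty (fun t => peval f (Phi t) - l0).
  exact: (meromorphicD (meromorphic_peval f HPhi) (meromorphic_cst (- l0))).
have [r3 r30 Hr3] := meromorphic_small Hf deg_neg delta0.
pose c := Num.min (al `^ nu) (be `^ nu).
have c0 : 0 < c by rewrite lt_min !powR_gt0.
pose p := d%:~R * nu - e%:~R.
have p0 : 0 < p by rewrite subr_gt0 mulrC -ltr_pdivrMr.
have [T T1 HT] := powR_growth (be2 / (A * c)) p0.
have X0 : 0 < B / al by rewrite divr_gt0.
pose x : R := r + r2 + r3 + T + B / al + 1.
pose t : C := (x%:C)%C.
have x1 : 1 <= x by rewrite /x; lra.
have x0 : 0 < x by lra.
have ct : cmod t = x by rewrite cmod_real gtr0_norm.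
have := Hr t; rewrite ct => /(_ ltac:(rewrite /x; lra))/andP[h1 h2].
have := Hr2 t; rewrite ct => /(_ ltac:(rewrite /x; lra)) h3.
have h4 := Hr3 t ltac:(rewrite ct /x; lra).
have xd : x <= x ^ d.
  by rewrite -[leLHS]expr1z ler_weXz2l // -gtz0_ge1.
have xd0 : 0 < x ^ d by rewrite exprz_gt0.
have HB : B < maxnorm (Phi t).
  apply: lt_le_trans h1; rewrite mulrC -ltr_pdivrMr //.
  by apply: lt_le_trans xd; rewrite /x; lra.
have := H (Phi t) h4 HB => h5.
have h6 : c * x `^ (d%:~R * nu) <= maxnorm (Phi t) `^ nu.
  have Ex : x `^ (d%:~R * nu) = (x ^ d) `^ nu
    by rewrite powRrM powR_intmul // ltW.
  have [nu0|nu0] := leP 0 nu.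
    apply: (@le_trans _ _ (al `^ nu * x `^ (d%:~R * nu))).
      by rewrite ler_wpM2r ?powR_ge0 // ge_min lexx.
    rewrite Ex -powRM ?(ltW al0) ?(ltW xd0) //.
    by apply: ge0_ler_powR => //;
      rewrite nnegrE ?maxnorm_ge0 // mulr_ge0 // ltW.
  apply: (@le_trans _ _ (be `^ nu * x `^ (d%:~R * nu))).
    by rewrite ler_wpM2r ?powR_ge0 // ge_min lexx orbT.
  rewrite Ex -powRM ?(ltW be0) ?(ltW xd0) // -[nu]opprK !(powRN _ (- nu)).
  rewrite lef_pV2 ?posrE ?powR_gt0 ?mulr_gt0 //; last by apply: lt_trans HB.
  by apply: ge0_ler_powR; rewrite ?nnegrE ?maxnorm_ge0 ?oppr_ge0 ?(ltW nu0) //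
    mulr_ge0 // ltW.
have := HT x ltac:(rewrite /x; lra); apply/negP; rewrite -leNgt.
rewrite ler_pdivlMr ?mulr_gt0 // /p powRB ?(gt_eqF x0) ?implybT //.
have xe : x `^ e%:~R = x ^ e by rewrite powR_intmul // ltW.
rewrite xe mulrAC ler_pdivrMr ?exprz_gt0 //.
apply: le_trans h3; apply: le_trans h5.
by rewrite mulrC -mulrA ler_wpM2l // ltW.
Qed.

End FiberExponent.

(** * From a sequence to a curve *)

Section RealCoordinates.
Variables (R : realType) (n : nat).
Local Notation C := (R[i])%C.
Implicit Types (x : 'rV[R]_(n + n)) (p : 'rV[C]_n).

Definition complex_point x : 'rV[C]_n :=
  \row_i (Complex (x 0 (lshift n i)) (x 0 (rshift n i))).

Definition real_point p : 'rV[R]_(n + n) :=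
  \row_j match fintype.split j with
         | inl i => complex.Re (p 0 i)
         | inr i => complex.Im (p 0 i)
         end.

Lemma real_pointK p : complex_point (real_point p) = p.
Proof.
apply/rowP => i; rewrite !mxE.
case: (split_ordP (lshift n i)) => j /eqP; last first.
  by rewrite eq_lrshift.
rewrite eq_shift => /eqP <-.
case: (split_ordP (rshift n i)) => k /eqP.
  by rewrite eq_rlshift.
by rewrite eq_shift => /eqP <-; case: (p 0 i).
Qed.

Definition sqmod (z : C) : R := complex.Re z ^+ 2 + complex.Im z ^+ 2.

Lemma sqmodE z : sqmod z = cmod z ^+ 2.
Proof.
by case: z => a b; rewrite /sqmod /cmod /= sqr_sqrtr // addr_ge0 // sqr_ge0.
Qed.

Lemma sumsq_complex_point x : sumsq x = \sum_i sqmod (complex_point x 0 i).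
Proof.
rewrite /sumsq big_split_ord /= -big_split /=; apply: eq_bigr => i _.
by rewrite mxE.
Qed.

Definition cpolyfun (h : 'rV[R]_(n + n) -> C) :=
  polyfun_row (fun x => complex.Re (h x)) /\ polyfun_row (fun x =>
    complex.Im (h x)).

Lemma cpolyfun_cst c : cpolyfun (fun=> c).
Proof. by split; exact: polyfun_cst. Qed.

Lemma cpolyfunD g h : cpolyfun g -> cpolyfun h -> cpolyfun (fun x => g x + h x).
Proof.
move=> [gr gi] [hr hi]; split; rewrite /polyfun_row.
- rewrite (_ : (fun e => _) = fun e =>
  complex.Re (g (row_at (n + n) e 1)) + complex.Re (h (row_at (n + n) e 1))).
    exact: (polyfunD gr hr).
  by apply/funext => e; case: (g _) (h _) => a b [c d].
- rewrite (_ : (fun e => _) = fun e =>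
  complex.Im (g (row_at (n + n) e 1)) + complex.Im (h (row_at (n + n) e 1))).
    exact: (polyfunD gi hi).
  by apply/funext => e; case: (g _) (h _) => a b [c d].
Qed.

Lemma cpolyfunM g h : cpolyfun g -> cpolyfun h -> cpolyfun (fun x => g x * h x).
Proof.
move=> [gr gi] [hr hi]; split; rewrite /polyfun_row.
- rewrite (_ : (fun e => _) = fun e =>
    complex.Re (g (row_at (n + n) e 1)) * complex.Re (h (row_at (n + n) e 1)) +
    - (complex.Im (g (row_at (n + n) e 1)) * complex.Im (h (row_at (n +
      n) e 1)))).
    exact: (polyfunD (polyfunM gr hr) (polyfunN (polyfunM gi hi))).
  by apply/funext => e; case: (g _) (h _) => a b [c d].
- rewrite (_ : (fun e => _) = fun e =>
    complex.Re (g (row_at (n + n) e 1)) * complex.Im (h (row_at (n + n) e 1)) +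
    complex.Im (g (row_at (n + n) e 1)) * complex.Re (h (row_at (n + n) e 1))).
    exact: (polyfunD (polyfunM gr hi) (polyfunM gi hr)).
  by apply/funext => e; case: (g _) (h _) => a b [c d].
Qed.

Lemma cpolyfun_coord i : cpolyfun (fun x => complex_point x 0 i).
Proof.
split; rewrite /polyfun_row.
- rewrite (_ : (fun e => _) = fun e => e (1 + lshift n i)%N);
  first exact: polyfun_var.
  by apply/funext => e; rewrite !mxE.
- rewrite (_ : (fun e => _) = fun e => e (1 + rshift n i)%N);
  first exact: polyfun_var.
  by apply/funext => e; rewrite !mxE.
Qed.

Lemma polyfun_sqmod h : cpolyfun h -> polyfun_row (fun x => sqmod (h x)).
Proof. by move=> [hr hi]; apply: polyfunD; exact: polyfunX. Qed.

End RealCoordinates.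

Section PolynomialInduction.
Variables (K : comNzRingType) (n : nat) (T : Type) (v : T -> 'I_n ->
  K) (P : (T -> K) -> Prop).
Hypothesis Pcst : forall c, P (fun=> c).
Hypothesis Pvar : forall i, P (fun t => v t i).
Hypothesis PD : forall g h, P g -> P h -> P (fun t => g t + h t).
Hypothesis PM : forall g h, P g -> P h -> P (fun t => g t * h t).

Lemma meval_induction (f : mpoly.mpoly n K) : P (fun t => mpoly.meval (v t) f).
Proof.
have PX g k : P g -> P (fun t => g t ^+ k).
  move=> Pg; elim: k => [|k IH]; first exact: (Pcst 1).
  rewrite (_ : (fun t => _) = fun t => g t * g t ^+ k); first exact: (PM Pg IH).
  by apply/funext => t; rewrite exprS.
have Pprod (s : seq 'I_n) (k : 'I_n ->
  nat) : P (fun t => \prod_(i <- s) v t i ^+ k i).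
  elim: s => [|i s IH].
    rewrite (_ : (fun t => _) = fun=> 1); first exact: Pcst.
    by apply/funext => t; rewrite big_nil.
  rewrite (_ : (fun t => _) = fun t =>
    v t i ^+ k i * \prod_(j <- s) v t j ^+ k j).
    exact: (PM (PX _ _ (Pvar i)) IH).
  by apply/funext => t; rewrite big_cons.
rewrite (_ : (fun t => _) = fun t => \sum_(m <- mpoly.msupp f)
   mpoly.mcoeff m f * \prod_(i <- index_enum 'I_n) v t i ^+
     mpoly.fun_of_multinom m i); last first.
  by apply/funext => t; rewrite mpoly.mevalE.
elim: (mpoly.msupp f) => [|m s IH].
  rewrite (_ : (fun t => _) = fun=> 0); first exact: Pcst.
  by apply/funext => t; rewrite big_nil.
rewrite (_ : (fun t => _) = fun t =>
   mpoly.mcoeff m f * \prod_(i <- index_enum 'I_n) v t i ^+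
     mpoly.fun_of_multinom m i
   + \sum_(j <- s) mpoly.mcoeff j f * \prod_(i <- index_enum 'I_n) v t i ^+
     mpoly.fun_of_multinom j i).
  by apply: (PD (PM (Pcst _) (Pprod _ _)) IH).
by apply/funext => t; rewrite big_cons.
Qed.

End PolynomialInduction.

Section Selection.
Variables (R : realType) (n : nat) (f : mpoly.mpoly n (R[i])%C) (l0 : (R[i])%C).
Local Notation C := (R[i])%C.

Lemma cpolyfun_peval (g : mpoly.mpoly n C) :
  cpolyfun (fun x => peval g (complex_point x)).
Proof.
apply: (meval_induction (v :=
  fun x i => complex_point x 0 i)) => [c|i|g1 h1|g1 h1].
- exact: cpolyfun_cst.
- exact: cpolyfun_coord.
- exact: cpolyfunD.
- exact: cpolyfunM.
Qed.

(* A violation of the Malgrange condition at scale [s], in Euclidean norms so as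
   to be polynomial. *)
Definition near_critical (s : R) (x : 'rV[R]_(n + n)) : Prop :=
  [/\ s ^+ 2 <= sumsq x,
      s ^+ 2 * sqmod (peval f (complex_point x) - l0) <= 1 &
      s ^+ 2 * (\sum_i \sum_j sqmod (complex_point x 0 i *
        peval (mpoly.mderiv j f) (complex_point x))) <= 1].

Let val_polyfun : polyfun_row (fun x => sqmod (peval f (complex_point x) - l0)).
Proof.
apply: (polyfun_sqmod (h := fun x => peval f (complex_point x) - l0)).
exact: (cpolyfunD (cpolyfun_peval f) (@cpolyfun_cst R n (- l0))).
Qed.

Let grad_polyfun : polyfun_row (fun x =>
  \sum_i \sum_j sqmod (complex_point x 0 i *
        peval (mpoly.mderiv j f) (complex_point x))).
Proof.
apply: polyfun_sum => i; apply: polyfun_sum => j.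
exact: (polyfun_sqmod (cpolyfunM (cpolyfun_coord R i) (cpolyfun_peval
  (mpoly.mderiv j f)))).
Qed.

Lemma semialg_near_critical : semialg_family near_critical.
Proof.
have ps : polyfun (fun e : nat -> R => e 0%N ^+ 2) by apply: polyfunX;
  exact: polyfun_var.
apply: semialg_ext (semialg_and (semialg_le ps (polyfun_row_sumsq R (n + n)))
  (semialg_and (semialg_le (polyfunM ps val_polyfun) (polyfun_cst 1))
               (semialg_le (polyfunM ps grad_polyfun) (polyfun_cst 1)))).
by move=> e; split=> [[? []]|[]].
Qed.

Lemma closed_near_critical s : closed (near_critical s).
Proof.
have cl (g : 'rV[R]_(n + n) -> R) (A : set R) : polyfun_row g -> closed A ->
  closed (g @^-1` A).
  move=> pg cA; apply: preimage_closed => // x _; exact: continuous_polyfun_row.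
have -> : near_critical s = (@sumsq R (n + n)) @^-1` [set y | s ^+ 2 <= y] `&`
  ((fun x => s ^+ 2 * sqmod (peval f
    (complex_point x) - l0)) @^-1` [set y | y <= 1] `&`
   (fun x => s ^+ 2 * (\sum_i \sum_j sqmod (complex_point x 0 i *
        peval (mpoly.mderiv j f) (complex_point x)))) @^-1` [set y | y <= 1]).
  by apply/seteqP; split=> x /= [] // ? [].
apply: closedI; first by apply: cl; [exact: polyfun_row_sumsq|exact: closed_ge].
apply: closedI; apply: cl; try exact: closed_le.
  exact: (polyfunM (polyfun_cst _) val_polyfun).
exact: (polyfunM (polyfun_cst _) grad_polyfun).
Qed.

Lemma near_critical_nonempty s : 1 <= s -> ~ malgrange f l0 ->
  near_critical s !=set0.
Proof.
move=> s1 nM; have s0 : 0 < s by lra.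
pose eta : R := (s * n.+1%:R)^-1.
have n0 : (0 : R) < n.+1%:R by rewrite ltr0n.
have eta0 : 0 < eta by rewrite invr_gt0 mulr_gt0.
have [p [lt_p f_p g_p]] : exists p : 'rV[C]_n, [/\ s < maxnorm p,
    cmod (peval f p - l0) < s^-1 & maxnorm p * maxnorm (grad f p) <= eta].
  apply: contrapT => nex; apply: nM; exists eta, s^-1, s;
    split=> // [|p lt_p f_p].
    by rewrite invr_gt0.
  by rewrite ltNge; apply/negP => g_p; apply: nex; exists p.
exists (real_point p); split; rewrite ?sumsq_complex_point real_pointK.
- have [i Hi] : exists i, s <= cmod (p 0 i).
    apply: contrapT => nex; have := lt_p; apply/negP; rewrite -leNgt.
    apply: maxnorm_le => [|i]; first exact: ltW.
    by rewrite leNgt; apply/negP => lt_s; apply: nex; exists i; exact: ltW.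
  rewrite (bigD1 i) //= sqmodE.
  apply: (@le_trans _ _ (cmod (p 0 i) ^+ 2)).
    by apply: lerXn2r => //; rewrite nnegrE; lra.
  by rewrite lerDl sumr_ge0 // => j _; rewrite sqmodE sqr_ge0.
- rewrite sqmodE -exprMn expr_le1 ?mulr_ge0 ?cmod_ge0 ?(ltW s0) //.
  by rewrite mulrC -ler_pdivlMr // mul1r ltW.
- have bound i j : sqmod (p 0 i * peval (mpoly.mderiv j f) p) <= eta ^+ 2.
    rewrite sqmodE; apply: lerXn2r; rewrite ?nnegrE ?cmod_ge0 ?(ltW eta0) //.
    apply: le_trans g_p; rewrite cmodM; apply: ler_pM;
      rewrite ?cmod_ge0 ?le_maxnorm //.
    by have := le_maxnorm (grad f p) j; rewrite mxE.
  apply: (@le_trans _ _ (s ^+ 2 * (\sum_(i < n) \sum_(j < n) eta ^+ 2))).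
    rewrite ler_wpM2l ?sqr_ge0 //; apply: ler_sum => i _; exact: ler_sum.
  rewrite !sumr_const !card_ord -mulrnA -[_ *+
    (n * n)]mulr_natr /eta exprVn exprMn.
  rewrite invfM mulrA mulrA divff ?expf_neq0 ?gt_eqF // mul1r mulrC ler_pdivrMr
    ?exprn_gt0 // mul1r.
  by rewrite -natrX ler_nat; lia.
Qed.

Lemma critical_sequence : ~ malgrange f l0 ->
  exists (x : R -> 'rV[R]_(n + n)) (Q : 'I_(n + n) -> {poly {poly R}}),
    (forall i, Q i != 0) /\
    forall s, 1 <= s -> near_critical s (x s) /\ forall i,
      (Q i).[(x s 0 i)%:P].[s] = 0.
Proof.
move=> nM; apply: algebraic_selection; first exact: semialg_near_critical.
by move=> s s1; split; [exact: closed_near_critical|exact: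
  near_critical_nonempty].
Qed.

End Selection.

Section PolynomialLipschitz.
Variables (R : realType) (n : nat).
Local Notation C := (R[i])%C.

(* Controls the effect of truncating a curve on the values of a polynomial. *)
Definition lip_bound (h : 'rV[C]_n -> C) (B : R) (D : nat) :=
  forall (r : R) a b, 1 <= r ->
  maxnorm a <= r -> maxnorm b <= r ->
  cmod (h a) <= B * r ^+ D /\ cmod (h a - h b) <= B * r ^+ D * maxnorm (a - b).

Definition poly_lip (h : 'rV[C]_n -> C) :=
  exists (B : R) (D : nat), 0 <= B /\ lip_bound h B D.

Lemma lip_bound_weaken h (B B' : R) D D' : 0 <= B -> B <= B' -> (D <= D')%N ->
  lip_bound h B D -> lip_bound h B' D'.
Proof.
move=> B0 BB' DD' H r a b r1 ar br; have [h1 h2] := H r a b r1 ar br.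
have rD : r ^+ D <= r ^+ D' by exact: ler_weXn2l.
have rD0 : 0 <= r ^+ D by rewrite exprn_ge0 //; lra.
have le : B * r ^+ D <= B' * r ^+ D' by exact: ler_pM.
split; first exact: le_trans le.
by apply: le_trans h2 _; rewrite ler_wpM2r // maxnorm_ge0.
Qed.

Lemma poly_lip_cst (c : C) : poly_lip (fun=> c).
Proof.
exists (cmod c), 0%N; split; first exact: cmod_ge0.
move=> r a b r1 ar br; rewrite expr0 mulr1 subrr cmod0.
by split=> //; rewrite mulr_ge0 ?cmod_ge0 ?maxnorm_ge0.
Qed.

Lemma poly_lip_coord (i : 'I_n) : poly_lip (fun z => z 0 i).
Proof.
exists 1, 1%N; split=> // r a b r1 ar br; rewrite mul1r expr1; split.
  exact: le_trans (le_maxnorm a i) ar.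
apply: (@le_trans _ _ (maxnorm (a - b)));
  first by have := le_maxnorm (a - b) i; rewrite !mxE.
by rewrite ler_peMl // maxnorm_ge0.
Qed.

Lemma poly_lipD g1 h1 : poly_lip g1 -> poly_lip h1 ->
  poly_lip (fun z => g1 z + h1 z).
Proof.
move=> [B [D [B0 H]]] [B' [D' [B0' H']]].
have {}H := lip_bound_weaken B0 (lexx _) (leq_maxl D D') H.
have {}H' := lip_bound_weaken B0' (lexx _) (leq_maxr D D') H'.
exists (B + B'), (maxn D D'); split; first by lra.
move=> r a b r1 ar br; have [h1a h1b] := H r a b r1 ar br;
  have [h2a h2b] := H' r a b r1 ar br.
split; first by apply: le_trans (cmodD _ _) _; rewrite mulrDl; exact: lerD.
rewrite opprD addrACA; apply: le_trans (cmodD _ _) _.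
by rewrite !mulrDl; exact: lerD.
Qed.

Lemma poly_lipM g1 h1 : poly_lip g1 -> poly_lip h1 ->
  poly_lip (fun z => g1 z * h1 z).
Proof.
move=> [B [D [B0 H]]] [B' [D' [B0' H']]].
exists (2 * B * B'), (D + D')%N; split; first by rewrite !mulr_ge0.
move=> r a b r1 ar br; have [h1a h1b] := H r a b r1 ar br;
  have [h2a h2b] := H' r a b r1 ar br.
have [h3a _] := H' r b a r1 br ar.
have rD : 0 <= r ^+ D by rewrite exprn_ge0 //; lra.
have rD' : 0 <= r ^+ D' by rewrite exprn_ge0 //; lra.
have m0 := maxnorm_ge0 (a - b).
rewrite exprD; split.
  rewrite cmodM; apply: (@le_trans _ _ (B * r ^+ D * (B' * r ^+ D'))).
    by apply: ler_pM; rewrite ?cmod_ge0.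
  rewrite -subr_ge0 (_ : _ - _ = B * B' * r ^+ D * r ^+ D'); last by ring.
  by rewrite !mulr_ge0.
have -> : g1 a * h1 a - g1 b * h1 b =
  g1 a * (h1 a - h1 b) + (g1 a - g1 b) * h1 b by ring.
apply: le_trans (cmodD _ _) _; rewrite !cmodM.
apply: (@le_trans _ _ (B * r ^+ D * (B' * r ^+ D' * maxnorm (a - b)) +
   B * r ^+ D * maxnorm (a - b) * (B' * r ^+ D'))).
  by apply: lerD; apply: ler_pM; rewrite ?cmod_ge0.
by rewrite le_eqVlt; apply/orP; left; apply/eqP; ring.
Qed.

Lemma poly_lip_peval (g : mpoly.mpoly n C) : poly_lip (peval g).
Proof.
apply: (meval_induction (v :=
  fun (z : 'rV[C]_n) i => z 0 i)) => [c|i|g1 h1|g1 h1].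
- exact: poly_lip_cst.
- exact: poly_lip_coord.
- exact: poly_lipD.
- exact: poly_lipM.
Qed.

Lemma poly_lip_uniform (I : finType) (h : I -> 'rV[C]_n ->
  C) : (forall i, poly_lip (h i)) ->
  exists (B : R) (D : nat), 0 <= B /\ forall i, lip_bound (h i) B D.
Proof.
move=> /choice[B /choice[D HD]].
have B0 i : 0 <= B i by have [] := HD i.
exists (\sum_i B i), (\max_i D i)%N; split; first exact: sumr_ge0.
move=> i; have [_] := HD i; apply: lip_bound_weaken => //;
  last exact: leq_bigmax.
by rewrite (bigD1 i) //= lerDl sumr_ge0.
Qed.

End PolynomialLipschitz.

Lemma norm_exprz (R : realFieldType) (x : R) (m : int) : `|x ^ m| = `|x| ^ m.
Proof. by case: m => k; rewrite ?NegzE -?exprnN ?normfV normrX. Qed.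

Lemma int_le_absz (m : int) : m <= (absz m)%:Z.
Proof. by lia. Qed.

Lemma laurent_bound (R : realType) (l : seq (R * int)) : exists (B : R)
  (D : nat), 0 <= B /\
  forall x : R, 1 <= `|x| -> `|laurent_eval id l x| <= B * `|x| ^+ D.
Proof.
elim: l => [|[c m] l [B [D [B0 H]]]].
  by exists 0, 0%N; split=> // x _; rewrite /laurent_eval big_nil normr0 mul0r.
exists (`|c| + B), (maxn D (absz m)); split=> [|x x1];
  first by rewrite addr_ge0.
rewrite /laurent_eval big_cons /=; apply: le_trans (ler_normD _ _) _;
  rewrite mulrDl.
apply: lerD.
  rewrite normrM ler_wpM2l // norm_exprz.
  apply: (@le_trans _ _ (`|x| ^ (absz m)%:Z));
    first by apply: ler_weXz2l => //; exact: int_le_absz.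
  by apply: ler_weXn2l => //; exact: leq_maxr.
apply: le_trans (H x x1) _; rewrite ler_wpM2l //; apply: ler_weXn2l => //.
exact: leq_maxl.
Qed.

Section LaurentCurve.
Variables (R : realType) (n : nat).
Local Notation C := (R[i])%C.
Local Notation toC := (fun x : R => (x%:C)%C).

Definition laurent_curve (l : 'I_(n + n) -> seq (R * int)) (t : C) : 'rV[C]_n :=
  \row_i (laurent_eval toC (l (lshift n i)) t +
    ('i)%C * laurent_eval toC (l (rshift n i)) t).

Lemma laurent_eval_real (l : seq (R * int)) (x : R) :
  laurent_eval toC l (x%:C)%C = ((laurent_eval id l x)%:C)%C.
Proof.
rewrite /laurent_eval rmorph_sum; apply: eq_bigr => cm _.
rewrite /= rmorphM /=; congr (_ * _).
by case: cm.2 => k; rewrite ?NegzE -?exprnN ?fmorphV rmorphXn.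
Qed.

Lemma laurent_curve_real l (x : R) : laurent_curve l (x%:C)%C =
  complex_point (\row_j laurent_eval id (l j) x).
Proof.
apply/rowP => i; rewrite !mxE !laurent_eval_real.
by rewrite [RHS]complexE.
Qed.

Lemma meromorphic_laurent_curve l i : meromorphic_at_infty (fun t =>
  laurent_curve l t 0 i).
Proof.
have H (s : seq (R * int)) : meromorphic_at_infty (laurent_eval toC s).
  apply: meromorphic_sum => cm.
  exact: (meromorphicM (meromorphic_cst _) (meromorphic_exprz _ _)).
rewrite (_ : (fun t => _) = fun t => laurent_eval toC (l (lshift n i)) t +
    ('i)%C * laurent_eval toC (l (rshift n i)) t).
  exact: (meromorphicD (H _) (meromorphicM (meromorphic_cst _) (H _))).
by apply/funext => t; rewrite mxE.
Qed.

Lemma cmod_le_abs (a b : R) : cmod (Complex a b) <= `|a| + `|b|.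
Proof.
rewrite /cmod /= -[leRHS]ger0_norm ?addr_ge0 // -sqrtr_sqr ler_wsqrtr //.
have := real_normK (num_real a); have := real_normK (num_real b).
have : 0 <= `|a| * `|b| by rewrite mulr_ge0.
rewrite !expr2; nra.
Qed.

Lemma maxnorm_complex_point (x : 'rV[R]_(n + n)) (e : R) : 0 <= e ->
  (forall j, `|x 0 j| <= e) -> maxnorm (complex_point x) <= 2 * e.
Proof.
move=> e0 H; apply: maxnorm_le => [|i]; first by lra.
rewrite mxE; apply: le_trans (cmod_le_abs _ _) _.
by have := H (lshift n i); have := H (rshift n i); lra.
Qed.

Lemma complex_pointB (x y : 'rV[R]_(n + n)) :
  complex_point x - complex_point y = complex_point (x - y).
Proof. by apply/rowP => i; rewrite !mxE. Qed.

Variables (U : set_system nat) (UU : UltraFilter U) (X : nat ->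
  'rV[R]_(n + n)) (u : nat -> R).
Hypothesis u_large : forall A, U [set k | A < `|u k|].
Hypothesis expansion : forall M : nat, exists l : 'I_(n + n) ->
  seq (R * int), forall i,
  (X k 0 i - laurent_eval id (l i) (u k)) * u k ^+ M @[k --> U] --> 0.

Lemma expansion_error M : exists l : 'I_(n + n) -> seq (R * int),
  U [set k | forall i, `|X k 0 i - laurent_eval id (l i)
    (u k)| * `|u k| ^+ M < 1].
Proof.
have [l Hl] := expansion M; exists l.
have PU := @ultra_proper _ _ UU.
apply: filter_forall => i.
have H : U [set k | `|(X k 0 i - laurent_eval id (l i) (u k)) * u k ^+ M| < 1].
  exact: (cvgr0_norm_lt _ (Hl i) _ ltr01).
by apply: filterS H => k /=; rewrite normrM normrX.
Qed.

Lemma polynomial_growth : exists G : nat,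
  U [set k | maxnorm (complex_point (X k)) <= `|u k| ^+ G].
Proof.
have PU := @ultra_proper _ _ UU.
have [l Hl] := expansion_error 0.
have /choice[B /choice[D HD]] : forall i, exists (B : R) (D : nat), 0 <= B /\
  forall x : R, 1 <= `|x| -> `|laurent_eval id (l i) x| <= B * `|x| ^+ D.
  by move=> i; exact: laurent_bound.
have B0 i : 0 <= B i by have [] := HD i.
pose BB := \sum_i B i; pose DD := (\max_i D i)%N.
have BB0 : 0 <= BB by exact: sumr_ge0.
exists DD.+2.
have H1 := u_large (BB + 2); apply: filterS2 Hl H1 => k /= Hk ltu.
have u1 : 1 <= `|u k| by lra.
have uD1 : 1 <= `|u k| ^+ DD by exact: exprn_ege1.
have bound j : `|X k 0 j| <= `|u k| ^+ DD.+1.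
  have := Hk j; rewrite expr0 mulr1 => Hj.
  have [_ /(_ (u k) u1) Hlau] := HD j.
  have le1 : B j * `|u k| ^+ D j <= BB * `|u k| ^+ DD.
    apply: ler_pM; rewrite ?exprn_ge0 //;
      first by rewrite /BB (bigD1 j) //= lerDl sumr_ge0.
    by apply: ler_weXn2l => //; exact: leq_bigmax.
  have tri : `|X k 0 j| <= `|X k 0 j - laurent_eval id (l j) (u k)| +
    `|laurent_eval id (l j) (u k)|.
    by rewrite -{1}[X k 0 j](subrK (laurent_eval id (l j) (u k))) ler_normD.
  rewrite exprS; apply: (@le_trans _ _ ((BB + 1) * `|u k| ^+ DD)).
    by rewrite mulrDl mul1r; lra.
  by rewrite ler_wpM2r ?exprn_ge0 //; lra.
apply: le_trans (maxnorm_complex_point _ bound) _; first exact: exprn_ge0.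
by rewrite [leRHS]exprS ler_wpM2r ?exprn_ge0 //; lra.
Qed.

Lemma laurent_approximation (I : finType) (h : I -> 'rV[C]_n -> C) :
  (forall o, poly_lip (h o)) ->
  exists l, (forall e : R, 0 < e -> U [set k |
      maxnorm (laurent_curve l ((u k)%:C)%C - complex_point (X k)) < e]) /\
    forall o (e : R), 0 < e -> U [set k |
      cmod (h o (laurent_curve l ((u k)%:C)%C) - h o (complex_point
        (X k))) < e].
Proof.
have PU := @ultra_proper _ _ UU.
move=> /poly_lip_uniform[B [D [B0 HB]]].
have [G HG] := polynomial_growth.
have [l Hl] := expansion_error (G.+1 * D).+1.
exists l.
have close : U [set k | maxnorm (laurent_curve l ((u k)%:C)%C - complex_point
  (X k)) * `|u k| ^+ (G.+1 * D).+1 <= 2].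
  apply: filterS2 Hl (u_large 1) => k /= Hk ltu.
  have uN : 0 < `|u k| ^+ (G.+1 * D).+1 by rewrite exprn_gt0 //; lra.
  rewrite -ler_pdivlMr // laurent_curve_real complex_pointB.
  apply: maxnorm_complex_point => [|j]; first by rewrite invr_ge0 ltW.
  by rewrite !mxE distrC -[leRHS]mul1r ler_pdivlMr //; exact: ltW.
split=> [e e0|o e e0].
  apply: filterS2 close (u_large (2 / e + 1)) => k /= Hk ltu.
  have e2 : 0 < 2 / e by rewrite divr_gt0.
  have u1 : 1 <= `|u k| by lra.
  have uN : `|u k| <= `|u k| ^+ (G.+1 * D).+1
    by rewrite exprS ler_peMr // exprn_ege1.
  have m0 := maxnorm_ge0 (laurent_curve l ((u k)%:C)%C - complex_point (X k)).
  have le2 : maxnorm (laurent_curve l ((u k)%:C)%C - complex_point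
    (X k)) * `|u k| <= 2.
    by apply: le_trans Hk; rewrite ler_wpM2l.
  have lt2 : 2 < e * `|u k| by rewrite mulrC -ltr_pdivrMr //; lra.
  by rewrite -(ltr_pM2r (_ : 0 < `|u k|)); lra.
apply: filterS3 close HG (u_large (2 + 2 * B / e)) => k /= Hk Gk ltu.
have Be : 0 <= 2 * B / e by rewrite divr_ge0 ?mulr_ge0 // ltW.
have u1 : 1 <= `|u k| by lra.
set a := laurent_curve l _ in Hk *; set b := complex_point _ in Hk Gk *.
have uN : 1 <= `|u k| ^+ (G.+1 * D) by exact: exprn_ege1.
have uG : 1 <= `|u k| ^+ G by exact: exprn_ege1.
have m0 := maxnorm_ge0 (a - b).
have E : `|u k| ^+ G.+1 ^+ D * `|u k| = `|u k| ^+ (G.+1 * D).+1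
  by rewrite -exprM exprSr.
have ab1 : maxnorm (a - b) <= 1.
  have : maxnorm (a - b) * 2 <= 2.
    apply: le_trans Hk; rewrite ler_wpM2l // exprS.
    apply: (@le_trans _ _ `|u k|); first by lra.
    by rewrite ler_peMr.
  by lra.
have bG : maxnorm b <= `|u k| ^+ G.+1.
  by apply: le_trans Gk _; rewrite exprS ler_peMl //; lra.
have aG : maxnorm a <= `|u k| ^+ G.+1.
  apply: (@le_trans _ _ (1 + maxnorm b)).
    apply: maxnorm_le => [|i]; first by have := maxnorm_ge0 b; lra.
    have := le_maxnorm (a - b) i; have := le_maxnorm b i.
    have := cmodD ((a - b) 0 i) (b 0 i); rewrite !mxE subrK; lra.
  apply: (@le_trans _ _ (2 * `|u k| ^+ G)); first by lra.
  by rewrite exprS ler_wpM2r //; lra.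
have [_ Hd] := HB o (`|u k| ^+ G.+1) a b (exprn_ege1 _ u1) aG bG.
apply: le_lt_trans Hd _.
rewrite -(ltr_pM2r (_ : 0 < `|u k|)); last by lra.
apply: (@le_lt_trans _ _ (B * 2)).
  rewrite -!mulrA ler_wpM2l // mulrCA E; exact: Hk.
by rewrite [ltRHS]mulrC -ltr_pdivrMr // [B * 2]mulrC; lra.
Qed.

End LaurentCurve.

Section CurveFromSequence.
Variables (R : realType) (n : nat) (f : mpoly.mpoly n (R[i])%C) (l0 : (R[i])%C).
Local Notation C := (R[i])%C.

Definition test_fun (o : option ('I_n * 'I_n)) (z : 'rV[C]_n) : C :=
  if o is Some ij then z 0 ij.1 * peval
    (mpoly.mderiv ij.2 f) z else peval f z - l0.

Lemma poly_lip_test_fun o : poly_lip (test_fun o).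
Proof.
case: o => [[i j]|]; first exact: (poly_lipM (poly_lip_coord R i)
  (poly_lip_peval _)).
exact: (poly_lipD (poly_lip_peval f) (poly_lip_cst n (- l0))).
Qed.

Lemma maxnorm_le_sum m (z : 'rV[C]_m) : maxnorm z <= \sum_i cmod (z 0 i).
Proof.
apply: maxnorm_le => [|i]; first by apply: sumr_ge0 => i _; exact: cmod_ge0.
by rewrite (bigD1 i) //= lerDl sumr_ge0 // => j _; exact: cmod_ge0.
Qed.

Lemma test_fun_near_critical s x o : 0 < s -> near_critical f l0 s x ->
  cmod (test_fun o (complex_point x)) <= s^-1.
Proof.
move=> s0 [_ Hf Hg].
have sq_le (z : C) : s ^+ 2 * sqmod z <= 1 -> cmod z <= s^-1.
  rewrite sqmodE -exprMn expr_le1 ?mulr_ge0 ?cmod_ge0 ?(ltW s0) //.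
  by rewrite -[s^-1]mul1r ler_pdivlMr // mulrC.
case: o => [[i j]|]; last exact: sq_le.
apply: sq_le; apply: le_trans Hg.
rewrite ler_wpM2l ?sqr_ge0 // (bigD1 i) //= (bigD1 j) //= -addrA lerDl.
by rewrite addr_ge0 // ?sumr_ge0 // => k _; rewrite ?sumr_ge0 // => *;
  rewrite sqmodE sqr_ge0.
Qed.

Lemma maxnorm_near_critical s x : 0 < s -> near_critical f l0 s x ->
  s <= n%:R * maxnorm (complex_point x).
Proof.
move=> s0 [Hs _ _].
have m0 := maxnorm_ge0 (complex_point x).
rewrite -(ler_pXn2r (_ : (0 < 2)%N)) ?nnegrE ?mulr_ge0 ?(ltW s0) //.
apply: le_trans Hs _; rewrite sumsq_complex_point.
apply: (@le_trans _ _ (\sum_(i < n) maxnorm (complex_point x) ^+ 2)).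
  apply: ler_sum => i _; rewrite sqmodE; apply: lerXn2r;
    rewrite ?nnegrE ?cmod_ge0 //.
  exact: le_maxnorm.
rewrite sumr_const card_ord -[_ *+ n]mulr_natr mulrC exprMn ler_wpM2r ?sqr_ge0
  //.
rewrite -natrX ler_nat; by case: (n) => // k; rewrite -mulnn leq_pmulr.
Qed.

Lemma Kinfty_curves : Kinfty f l0 -> (loj_infty_curves f l0 < (-1)%:E)%E.
Proof.
move=> nM; have [x [Q [nz_Q Hx]]] := critical_sequence nM.
pose s (k : nat) : R := k.+1%:R.
have s1 k : 1 <= s k by rewrite ler1n.
have s0 k : 0 < s k by rewrite ltr0n.
have [U [u [UU ooU u_large Hexp]]] :=
  @algebraic_sequence_expansion R (n + n) (fun k i => x (s k) 0 i) Q nz_Q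
    (fun i k => (Hx (s k) (s1 k)).2 i).
have PU := @ultra_proper _ _ UU.
have U_meet (A B : set nat) : U A -> U B -> exists2 k, A k & B k.
  move=> UA UB; have UAB : U (A `&` B) by exact: filterI.
  by have [k [Ak Bk]] := filter_ex UAB; exists k.
have s_large A : U [set k | A < s k].
  apply: ooU; have := @nbhs_infty_gtr R A; apply: filterS => k /= ltA.
  by apply: lt_trans ltA _; rewrite ltr_nat.
have [l [Hclose Htest]] := laurent_approximation UU (X :=
  fun k => x (s k)) u_large Hexp
  poly_lip_test_fun.
pose Phi := laurent_curve l; pose t (k : nat) : C := ((u k)%:C)%C.
have ct k : cmod (t k) = `|u k| by rewrite cmod_real.
have HPhi i : meromorphic_at_infty (fun t => Phi t 0 i)
  by exact: meromorphic_laurent_curve.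
have test_small o (e : R) : 0 < e ->
  U [set k | cmod (test_fun o (Phi (t k))) < e].
  move=> e0; have e2 : 0 < e / 2 by rewrite divr_gt0.
  apply: filterS2 (Htest o _ e2) (s_large (2 / e)) => k /= H1 H2.
  have [nc _] := Hx (s k) (s1 k).
  have H3 := test_fun_near_critical o (s0 k) nc.
  have H4 : (s k)^-1 < e / 2.
    by rewrite -[e / 2]invrK invf_div ltf_pV2 ?posrE // divr_gt0.
  rewrite -[test_fun o _](subrK (test_fun o (complex_point (x (s k))))).
  apply: le_lt_trans (cmodD _ _) _.
  by rewrite [e]splitr ltrD // (le_lt_trans H3).
have Phi_large A : U [set k | A < maxnorm (Phi (t k))].
  apply: filterS2 (Hclose 1 ltr01) (s_large (n%:R * (`|A| + 1))) => k /= H1 H2.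
  have [nc _] := Hx (s k) (s1 k).
  have H3 := maxnorm_near_critical (s0 k) nc.
  have H4 : `|A| + 1 < maxnorm (complex_point (x (s k))).
    rewrite ltNge; apply/negP => le_A.
    have : n%:R * maxnorm (complex_point (x (s k))) <= n%:R * (`|A| + 1).
      by rewrite ler_wpM2l.
    by lra.
  have H5 : maxnorm (complex_point (x (s k))) <= maxnorm (Phi (t k)) + 1.
    apply: maxnorm_le => [|i]; first by have := maxnorm_ge0 (Phi (t k)); lra.
    have := le_maxnorm (Phi (t k) - complex_point (x (s k))) i.
    have := le_maxnorm (Phi (t k)) i.
    have := cmodB (Phi (t k) 0 i) ((Phi (t k) - complex_point (x (s k))) 0 i).
    rewrite !mxE subKr; move: H1; rewrite -/Phi -/(t k); lra.
  by have := ler_norm A; lra.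
have HG i : meromorphic_at_infty (fun t => grad f (Phi t) 0 i).
  rewrite (_ : (fun t => _) = fun t => peval (mpoly.mderiv i f) (Phi t)).
    exact: meromorphic_peval.
  by apply/funext => z; rewrite mxE.
have [[[r r0 Hr] _]|[d [al [be [r [al0 be0 r0 Hr]]]] Ed]] :=
  tuple_deg_cases HPhi.
  have [k /= Hk1 Hk2] := U_meet _ _ (u_large r) (Phi_large 0).
  by move: Hk2; rewrite Hr ?ltxx // ct.
have d0 : 0 < d.
  rewrite ltNge; apply/negP => d0.
  have [k /= Hk1 Hk2] := U_meet _ _ (u_large (r + 1)) (Phi_large be).
  have := Hr (t k); rewrite ct => /(_ ltac:(lra))/andP[_]; apply/negP;
    rewrite -ltNge.
  apply: le_lt_trans Hk2; rewrite ler_piMr ?(ltW be0) //.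
  rewrite -[leRHS](expr0z `|u k|); apply: ler_weXz2l => //; lra.
have dR : (0 : R) < d%:~R by rewrite ltr0z.
have Phi_adm : admissible_curve f l0 Phi.
  split=> //; first by rewrite Ed lte_fin.
  have Hf : meromorphic_at_infty (fun t => peval f (Phi t) - l0).
    exact: (meromorphicD (meromorphic_peval f HPhi) (meromorphic_cst (- l0))).
  have [[_ ->]|[p [al' [be' [r' [al'0 be'0 r'0 Hr']]]] ->]] :=
    meromorphic_cases Hf.
    exact: ltNy0.
  rewrite lte_fin ltrz0 ltNge; apply/negP => p0.
  have [k /= Hk1 Hk2] := U_meet _ _ (u_large (r' +
    1)) (test_small None al' al'0).
  have := Hr' (t k); rewrite ct => /(_ ltac:(lra))/andP[+ _]; apply/negP;
    rewrite -ltNge.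
  apply: (lt_le_trans Hk2); rewrite ler_peMr ?(ltW al'0) //.
  rewrite -[leLHS](expr0z `|u k|); apply: ler_weXz2l => //; lra.
apply: (@le_lt_trans _ _ (tuple_deg_infty (fun t =>
  grad f (Phi t)) / tuple_deg_infty Phi)%E).
  by apply: ereal_inf_lbound; exists Phi.
rewrite Ed inver gt_eqF //.
have [[_ ->]|[e [al' [be' [r' [al'0 be'0 r'0 Hr']]]] ->]] := tuple_deg_cases HG.
  by rewrite gt0_mulNye ?ltNyr // lte_fin invr_gt0.
rewrite -EFinM lte_fin ltr_pdivrMr // mulN1r -rmorphN /= ltr_int ltNge;
  apply/negP => le_de.
have all_small : U [set k | forall o,
  cmod (test_fun o (Phi (t k))) < al * al' / (n * n).+1%:R].
  by apply: filter_forall => o; apply: test_small; rewrite divr_gt0 ?mulr_gt0.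
have [k /= Hk1 Hk2] := U_meet _ _ (u_large (r + r' + 1)) all_small.
have := Hr (t k); rewrite ct => /(_ ltac:(lra))/andP[h1 _].
have := Hr' (t k); rewrite ct => /(_ ltac:(lra))/andP[h2 _].
have u1 : 1 <= `|u k| by lra.
have u0 : 0 < `|u k| by lra.
have low : al * al' <= maxnorm (Phi (t k)) * maxnorm (grad f (Phi (t k))).
  apply: (@le_trans _ _ (al * `|u k| ^ d * (al' * `|u k| ^ e))); last first.
    by apply: ler_pM => //; rewrite mulr_ge0 ?exprz_ge0 // ltW.
  rewrite mulrACA -expfzDr ?gt_eqF // ler_peMr ?mulr_ge0 ?(ltW al0) ?(ltW al'0)
    //.
  by rewrite -[leLHS](expr0z `|u k|); apply: ler_weXz2l => //;
    rewrite -lerBlDl sub0r.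
have high : maxnorm (Phi (t k)) * maxnorm (grad f (Phi (t k))) <=
    \sum_(i < n) \sum_(j < n) al * al' / (n * n).+1%:R.
  apply: (@le_trans _ _ ((\sum_i cmod (Phi (t k) 0 i)) * (\sum_j cmod (grad f
    (Phi (t k)) 0 j)))).
    by apply: ler_pM; rewrite ?maxnorm_ge0 ?maxnorm_le_sum.
  rewrite mulr_suml; apply: ler_sum => i _; rewrite mulr_sumr;
    apply: ler_sum => j _.
  by rewrite -cmodM [grad _ _ _ _]mxE; apply/ltW/(Hk2 (Some (i, j))).
have := le_trans low high; apply/negP; rewrite -ltNge.
rewrite !sumr_const !card_ord -mulrnA -[_ *+
  (n * n)]mulr_natr mulrAC ltr_pdivrMr //.
by rewrite ltr_pM2l ?mulr_gt0 // ltr_nat.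
Qed.

End CurveFromSequence.

Unset Implicit Arguments.

Theorem theorem6p1 (R : realType) (n : nat) (n_ge2 : (2 <= n)%N)
  (f : mpoly.mpoly n R[i])
  (f_nonconst : ~ exists c : R[i], f = mpoly.mpolyC n c)
  (lambda0 : R[i]) :
  (Kinfty f lambda0 <-> (loj_infty_fiber f lambda0 < (-1)%:E)%E) /\
  ((loj_infty_fiber f lambda0 < (-1)%:E)%E <->
   (loj_infty_curves f lambda0 < (-1)%:E)%E).
Proof.
have fiber_K : (loj_infty_fiber f lambda0 < (-1)%:E)%E -> Kinfty f lambda0.
  by move=> lt1 M; have := malgrange_fiber M; rewrite leNgt lt1.
have K_curves := @Kinfty_curves R n f lambda0.
have curves_fiber := @curve_fiber R n f lambda0.
by tauto.
Qed.
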